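(* Let $G$ be a soluble CPPO-group. Then: (a) the Fitting height of $G$ is at most $3$; (b) the order of the commutator subgroup $G'$ is divisible by at most $3$ primes.
   Context: A commutator in a group $G$ is an element of the form $[x,y]=x^{-1}y^{-1}xy$ with $x,y\in G$; $G'$ is the commutator subgroup of $G$ (the subgroup generated by all commutators). A CPPO-group is a finite group in which every commutator has prime power order (the identity, of order $1=p^0$, counts as having prime power order). The Fitting height of a finite soluble group $G$ is the minimal $h$ such that $G$ has a normal series of length $h$ all of whose factors are nilpotent. *)

(* Defs.v *)
From HB Require Import structures.
From mathcomp Require Import all_boot all_fingroup all_solvable.

Set Implicit Arguments.
Unset Strict Implicit.
Unset Printing Implicit Defensive.

Local Open Scope group_scope.

(* The library commutator [~ x, y] = x^-1 * x ^ y is x^-1 * y^-1 * x * y.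
   The value k = 0 accounts for trivial commutators. *)
Definition CPPO (gT : finGroupType) (G : {group gT}) : Prop :=
  forall x y : gT, x \in G -> y \in G ->
    exists p k : nat, prime p /\ #[[~ x, y]] = (p ^ k)%N.

(* There is a series 1 = G_0 <= G_1 <= ... <= G_h = G of normal subgroups of G
   with every G_(i+1) / G_i nilpotent; the tuple s is (G_1, ..., G_h). *)
Definition has_nilpotent_series (gT : finGroupType) (G : {group gT}) (h : nat)
    : bool :=
  [exists s : h.-tuple {group gT},
    [&& (G.-invariant).-series 1%G s,
        path [rel H K : {group gT} | nilpotent (K / H)] 1%G s
      & last 1%G s == G]].

Lemma solvable_has_nilpotent_series (gT : finGroupType) (G : {group gT}) :
  solvable G -> exists h, has_nilpotent_series G h.
Proof.
move=> /derivedP[n Gn1].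
suff [s /and3P[s1 s2 s3]] : exists s : seq {group gT},
    [&& (G.-invariant).-series G^`(n)%G s,
        path [rel H K : {group gT} | nilpotent (K / H)] G^`(n)%G s
      & last G^`(n)%G s == G].
  have E : G^`(n)%G = 1%G by apply: val_inj.
  rewrite E in s1 s2 s3.
  by exists (size s); apply/existsP; exists (in_tuple s); apply/and3P.
elim: n {Gn1} => [|n [s /and3P[s1 s2 s3]]].
  by exists [::]; rewrite /=; apply/eqP/val_inj.
exists (G^`(n)%G :: s); rewrite /= s1 s2 s3 /= !andbT.
rewrite abelian_nil ?der_abelian // andbT /invariant_factor.
by rewrite !normal_norm ?der_normal //= der_normalS.
Qed.

Definition fitting_height (gT : finGroupType) (G : {group gT})
    (solG : solvable G) : nat :=
  ex_minn (solvable_has_nilpotent_series solG).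

(* Main.v *)
Require Import Defs.
From mathcomp Require Import all_boot all_fingroup all_solvable.
From mathcomp Require Import ssralg finalg mxrepresentation mxabelem.

(** Everything rests on one computation.  Let x and y normalise an abelian
    r-group K and let h = [x, y] be a nontrivial r'-element.  Multiplying x and
    y by elements of K replaces h by hk, where k runs over the whole of
    [K, <x, y>]; if some k <> 1 there commuted with h, then the commutator hk
    would have mixed order.  Hence h fixes nothing in [K, <x, y>], and if h lies
    in an r'-group normalised by x and y, whatever h fixes in K is fixed by x
    and by y ([commutator_fixed_points]).  For an abelian r'-group A faithful
    on K this makes every [A, x] cyclic ([comm_cycle_cyclic]).

    (a) The Fitting height is at most 3 exactly when the third iterated
    nilpotent residual is trivial.  Take G of least order where it is not.  Two
    normal subgroups of coprime orders cannot both be noncentral, so each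
    factor of the residual series has prime power order, and G contains a tower:
    an abelian r-group K, a q-group Q faithful on K, an s-group S acting on Q,
    and an s'-element t such that [S, t] acts nontrivially on Q; here r <> q and
    q <> s.  Such towers do not exist ([tower_cent]).  In a smallest one Q is
    special and nonabelian, and every sigma = [a, t] with a in S that is
    nontrivial on Q fixes no nontrivial element of V = Q / Z(Q).
    - If q is odd, the commutators h = [u, sigma] have order q.  Were h not to
      commute with its sigma-conjugates, its fixed points on K would contradict
      the computation above; so these conjugates generate an abelian group A
      with [A, sigma] cyclic, and sigma normalises every line of V.  Then sigma
      acts on V by scalars, commutes with t there, and S = [S, t] centralises V.
    - If q = 2, noncentral elements of Q have squares outside a suitable
      subgroup of index 2 of Z(Q), so V is a four-group.  If t fixed nothing in
      V, it would be a 3-cycle on the involutions of V, as sigma is, and would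
      commute with sigma.  So t fixes a coset cZ(Q), and for some b in Q the
      commutators [tb, a] and [tb, ca] differ by a nontrivial central 2-element,
      although both have prime power order and neither is a 2-element.

    (b) Passing from G / F(G) to G adds at most one prime to the order of the
    commutator subgroup ([primes_der1_Fitting]): all but one of the O_p(G) are
    central, and transfer handles the central part of F(G).  By (a), three such
    steps reach the trivial group. *)

Set Implicit Arguments.
Unset Strict Implicit.
Unset Printing Implicit Defensive.

Local Open Scope group_scope.

(** * Orders of commutators and coprime action *)

Lemma prime_power_dvd d p k : prime p -> d %| p ^ k -> exists j, d = (p ^ j)%N.
Proof. by move=> p_pr /dvdn_pfactor[] // j _ ->; exists j. Qed.

Lemma CPPO_quotient (gT : finGroupType) (G N : {group gT}) :
  CPPO G -> CPPO (G / N).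
Proof.
move=> cG _ _ /morphimP[x Nx Gx ->] /morphimP[y Ny Gy ->].
have [p [k [p_pr oxy]]] := cG x y Gx Gy.
have [j oj] : exists j, #[coset N [~ x, y]] = (p ^ j)%N.
  by apply: (@prime_power_dvd _ p k); rewrite // -oxy morph_order ?groupR.
by exists p, j; rewrite -morphR.
Qed.

(** The only way in which the hypothesis on commutators is ever contradicted. *)
Lemma prime_power_not_mixed (gT : finGroupType) (pi : nat_pred) (u v : gT) p k :
    commute u v -> pi.-elt u -> pi^'.-elt v -> u != 1 -> v != 1 ->
  prime p -> #[u * v] = (p ^ k)%N -> False.
Proof.
move=> cuv piu pi'v u1 v1 p_pr ouv.
have co : coprime #[u] #[v] by apply: pnat_coprime piu pi'v.
have := orderM cuv co; rewrite ouv => o.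
have [i oi] : exists i, #[u] = (p ^ i)%N.
  by apply: (@prime_power_dvd _ p k); rewrite // o dvdn_mulr.
have [j oj] : exists i, #[v] = (p ^ i)%N.
  by apply: (@prime_power_dvd _ p k); rewrite // o dvdn_mull.
move: u1 v1; rewrite -!order_eq1 oi oj.
case: i oi => [|i] oi //; case: j oj => [|j] oj // _ _.
move: co; rewrite oi oj !expnS coprimeMl !coprimeMr.
by rewrite /coprime gcdnn (gtn_eqF (prime_gt1 p_pr)).
Qed.

(** Centralisers pass to quotients under coprime action, and A acts trivially on
    K / [K, A]. *)
Lemma coprime_comm_cent_prod (gT : finGroupType) (A K : {group gT}) :
    solvable K -> A \subset 'N(K) -> coprime #|K| #|A| ->
  [~: K, A] * 'C_K(A) = K.
Proof.
move=> solK nKA coKA; set R := [~: K, A]%G.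
have sRK : R \subset K by rewrite commg_subl.
have nRA : A \subset 'N(R) by rewrite commg_normr.
have nRK : K \subset 'N(R) by rewrite commg_norml.
have := coprime_quotient_cent sRK nRA coKA solK.
have -> : 'C_(K / R)(A / R) = K / R.
  by apply/setIidPl; rewrite quotient_cents2r.
move=> E; apply/eqP; rewrite eqEsubset mul_subG ?subsetIl //=.
by rewrite -quotientSK //= E.
Qed.

Lemma coprime_commg_id (gT : finGroupType) (A K : {group gT}) :
    solvable K -> A \subset 'N(K) -> coprime #|K| #|A| ->
  [~: K, A, A] = [~: K, A].
Proof.
move=> solK nKA coKA; set R := [~: K, A].
have sRK : R \subset K by rewrite commg_subl.
apply/eqP; rewrite eqEsubset commSg //= gen_subG.
apply/subsetP=> _ /imset2P[k a Kk Aa ->].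
move: Kk; rewrite -(coprime_comm_cent_prod solK nKA coKA) => /mulsgP[x c Rx].
case/setIP=> Kc cc ->; rewrite commMgJ.
have /commgP/eqP-> : commute c a by apply: (centP cc).
have ac : a ^ c = a by apply/conjg_fixP/commgP/commute_sym/(centP cc).
rewrite mulg1 conjRg ac mem_commg // memJ_norm //.
by apply: (subsetP (commg_norml _ _)).
Qed.

(** * Commutators perturbed by an abelian normal section *)

(** Commutators with the powers of t unfold into conjugates under t of
    commutators with t itself, so that only the latter need checking. *)
Lemma comm_cycle_sub (gT : finGroupType) (S D : {group gT}) t :
    t \in 'N(D) -> (forall a, a \in S -> [~ a, t] \in D) ->
  [~: S, <[t]>] \subset D.
Proof.
move=> nDt H; rewrite gen_subG;
  apply/subsetP=> _ /imset2P[a _ Sa /cycleP[i ->] ->].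
elim: i => [|i IHi]; first by rewrite expg0 commg1 group1.
by rewrite expgSr commgMJ groupM ?H // memJ_norm.
Qed.

(** On an abelian group, commutation with a fixed element is an endomorphism, so
    its values already form the whole subgroup [K, <g>]. *)
Lemma comm_cycle_abelian (gT : finGroupType) (K : {group gT}) g m :
  abelian K -> g \in 'N(K) -> m \in [~: K, <[g]>] ->
  exists2 w, w \in K & m = [~ w, g].
Proof.
move=> abK nKg; have cK := centsP abK.
have KJ w : w \in K -> w ^ g \in K by move=> Kw; rewrite memJ_norm.
have gD : group_set [set [~ w, g] | w in K].
  apply/group_setP; split=> [|_ _ /imsetP[u Ku ->] /imsetP[v Kv ->]].
    by apply/imsetP; exists 1; rewrite ?group1 ?comm1g.
  apply/imsetP; exists (u * v); first exact: groupM.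
  rewrite commMgJ; congr (_ * _); apply/esym/conjg_fixP/commgP/cK => //.
  by rewrite commgEl groupM ?groupV ?KJ.
have sD : [~: K, <[g]>] \subset Group gD.
  apply: comm_cycle_sub => [|a Ka]; last exact: imset_f.
  rewrite inE; apply/subsetP=> _ /imsetP[_ /imsetP[u Ku ->] ->].
  by apply/imsetP; exists (u ^ g); rewrite ?KJ // conjRg [g ^ g]conjgE mulKg.
by move/(subsetP sD)/imsetP=> [w Kw ->]; exists w.
Qed.

Ltac group_id :=
  rewrite /commg /conjg; do ?rewrite !(invMg, invgK, mulgA);
  do ?rewrite ?(mulgK, mulgKV, mulVg, mulgV, mul1g, mulg1).

(** Perturbing x inside K changes the commutator by a value of [_, h^-1 y], then
    perturbing y changes it by the inverse of a value of [_, x^y].  The elements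
    h^-1 y and x^y generate the same group as x and y. *)
Lemma commutator_perturb (gT : finGroupType) (K : {group gT}) x y u w :
    abelian K -> x \in 'N(K) -> y \in 'N(K) -> u \in K -> w \in K ->
  let h := [~ x, y] in
  [~ x * u ^ h^-1, y * w] = h * ([~ u, h^-1 * y] * [~ w, x ^ y]^-1).
Proof.
move=> abK nKx nKy Ku Kw h; set v := u ^ h^-1.
have Kv : v \in K by rewrite memJ_norm ?groupV ?groupR.
have xvy : [~ x * v, y] = h * [~ u, h^-1 * y].
  by rewrite /v /h; group_id.
have -> : [~ x * v, y * w] = [~ x * v, y] * [~ w, (x * v) ^ y]^-1.
  by move: v {xvy Kv} => v; group_id.
rewrite xvy -mulgA; congr (_ * (_ * _^-1)).
rewrite !commgEl conjMg conjgM; congr (_ * _).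
have Kwxy : w ^ (x ^ y) \in K by rewrite memJ_norm //; apply: groupJ.
by apply/conjg_fixP/commgP/(centsP abK); rewrite // memJ_norm.
Qed.

(** Every h m with m in [K, <x, y>] is a commutator by [commutator_perturb], and
    it has mixed order when m <> 1 commutes with h. *)
Lemma commutator_fixes_none (gT : finGroupType) (G K : {group gT}) (r : nat)
    x y m :
    CPPO G -> K \subset G -> abelian K -> r.-group K ->
    x \in G -> y \in G -> x \in 'N(K) -> y \in 'N(K) ->
    [~ x, y] != 1 -> r^'.-elt [~ x, y] ->
  m \in [~: K, <[x]> <*> <[y]>] -> commute m [~ x, y] -> m = 1.
Proof.
move=> cG sKG abK rK Gx Gy nKx nKy; set h := [~ x, y] => h1 r'h Lm cmh.
set g1 := h^-1 * y; set g2 := x ^ y.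
have nKh : h \in 'N(K) by rewrite groupR.
have nK1 : <[g1]> \subset 'N(K) by rewrite cycle_subG groupM ?groupV.
have nK2 : <[g2]> \subset 'N(K) by rewrite cycle_subG groupJ.
have cen1 : [~: K, <[g2]>] \subset 'N([~: K, <[g1]>]).
  apply: cents_norm; apply: centSS abK; rewrite commg_subl //.
set R := [~: K, <[g1]>] <*> [~: K, <[g2]>].
have sRK : R \subset K by rewrite join_subG !commg_subl nK1.
have nR g : <[g]> \subset 'N(K) -> [~: K, <[g]>] \subset R ->
  <[g]> \subset 'N(R).
  by move=> nKg sR; rewrite -commg_subl (subset_trans _ sR) // commSg.
have nR1 : <[g1]> \subset 'N(R) by apply: nR; rewrite ?joing_subl.
have nR2 : <[g2]> \subset 'N(R) by apply: nR; rewrite ?joing_subr.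
have nRK : K \subset 'N(R) by apply: cents_norm; apply: centSS abK.
have sL : <[x]> <*> <[y]> \subset <[g1]> <*> <[g2]>.
  have J1 : g1 \in <[g1]> <*> <[g2]> by rewrite mem_gen ?inE ?cycle_id.
  have J2 : g2 \in <[g1]> <*> <[g2]> by rewrite mem_gen ?inE ?cycle_id ?orbT.
  have Jy : y \in <[g1]> <*> <[g2]>.
    suff <- : g1 ^ g2^-1 = y by rewrite groupJ ?groupV.
    by rewrite /g1 /g2 /h; group_id.
  rewrite join_subG !cycle_subG Jy.
  by rewrite -(conjgK y x) groupJ // groupV.
have {}Lm : m \in R.
  move/(subsetP (commgS K sL)): Lm; apply: subsetP.
  rewrite commGC -quotient_cents2 ?join_subG ?nR1 ?nR2 // quotientY //.
  by rewrite join_subG !quotient_cents2r // commGC ?joing_subl ?joing_subr.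
have Km := subsetP sRK m Lm.
move: Lm; rewrite /R norm_joinEr // => /mulsgP[m1 m2].
case/(comm_cycle_abelian abK) => [|u Ku ->]; first by rewrite -cycle_subG.
rewrite -groupV => /(comm_cycle_abelian abK)[|w Kw /(canRL invgK) ->].
  by rewrite -cycle_subG.
move=> Em; apply/eqP; apply/negPn/negP=> m1'.
have [] := cG (x * u ^ h^-1) (y * w).
- by rewrite groupM // groupJ ?groupV ?groupR //; apply: (subsetP sKG).
- by rewrite groupM //; apply: (subsetP sKG).
move=> p [k [p_pr]]; rewrite (commutator_perturb abK) // -Em -/h => o.
apply: (@prime_power_not_mixed _ r m h p k) => //; first exact: mem_p_elt rK Km.
by rewrite cmh.
Qed.

(** N meets <x, y> in an r'-group N0 that contains h, so K is the product of
    [K, N0] and C_K(N0).  As h fixes nothing in [K, N0], a fixed point of h lies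
    in C_K(N0); its commutator with an element of <x, y> lies there too, hence
    is fixed by h while lying in [K, <x, y>], and so is trivial. *)
Lemma commutator_fixed_points (gT : finGroupType) (G K N : {group gT}) (r : nat)
    x y :
    CPPO G -> K \subset G -> abelian K -> r.-group K -> r^'.-group N ->
    x \in G -> y \in G -> x \in 'N(K) -> y \in 'N(K) ->
    x \in 'N(N) -> y \in 'N(N) -> [~ x, y] \in N -> [~ x, y] != 1 ->
  'C_K[[~ x, y]] \subset 'C(<[x]> <*> <[y]>).
Proof.
move=> cG sKG abK rK r'N Gx Gy nKx nKy nNx nNy; set h := [~ x, y] => Nh h1.
set L := <[x]> <*> <[y]>.
have Lx : x \in L by rewrite mem_gen ?inE ?cycle_id.
have Ly : y \in L by rewrite mem_gen ?inE ?cycle_id ?orbT.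
have nKL : L \subset 'N(K) by rewrite join_subG !cycle_subG nKx.
have nNL : L \subset 'N(N) by rewrite join_subG !cycle_subG nNx.
have TI m : m \in [~: K, L] -> commute m h -> m = 1.
  by move=> Lm cmh; apply: (commutator_fixes_none cG sKG abK rK Gx Gy) => //;
    apply: mem_p_elt r'N Nh.
pose N0 := (N :&: L)%G.
have N0h : h \in N0 by rewrite inE Nh groupR.
have nKN0 : N0 \subset 'N(K) by rewrite subIset // nKL orbT.
have nN0L : L \subset 'N(N0) by rewrite normsI ?normG.
have coKN0 : coprime #|K| #|N0|.
  by apply: pnat_coprime rK (pgroupS _ r'N); apply: subsetIl.
apply/subsetP=> m /setIP[Km /cent1P cmh].
have Cm : m \in 'C_K(N0).
  move: (Km); rewrite -{1}(coprime_comm_cent_prod (abelian_sol abK) nKN0 coKN0).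
  case/mulsgP=> d c Rd /setIP[Kc cc] Em.
  suff d1 : d = 1 by rewrite Em d1 mul1g inE Kc.
  apply: TI; first by rewrite (subsetP (commgS K _) d Rd) ?subsetIr.
  have -> : d = m * c^-1 by rewrite Em mulgK.
  apply: commute_sym; apply: commuteM; first exact: commute_sym.
  by apply/commuteV/commute_sym/(centP cc).
suff cent_g g : g \in L -> commute m g.
  by apply/centP=> g Lg; apply: cent_g.
move=> Lg; apply/commgP/eqP/TI.
  exact: mem_commg.
apply/esym; have : [~ m, g] \in 'C_K(N0).
  rewrite commgEl groupM ?groupV // memJ_norm //.
  by rewrite (subsetP _ g Lg) // normsI // norms_cent.
by case/setIP=> _ /centP/(_ h N0h)/commute_sym.
Qed.

(** * Abelian groups acting on abelian groups *)

(** On a minimal A-invariant subgroup of [K, A] the abelian group A acts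
    irreducibly, so by Schur's lemma through a cyclic quotient A / B; that
    subgroup is centralised by B but not by A.  When A is not cyclic, B is not
    trivial, and a nontrivial element of A fixes something that A moves. *)
Lemma abelian_action_cyclic_quotient (gT : finGroupType) (A K : {group gT}) :
    abelian A -> abelian K -> A \subset 'N(K) -> coprime #|K| #|A| ->
    ~~ (K \subset 'C(A)) ->
  exists B : {group gT},
    [/\ B \subset A, cyclic (A / B) & ~~ ('C_K(B) \subset 'C(A))].
Proof.
move=> abA abK nKA coKA nKC; set R := [~: K, A]%G.
have sRK : R \subset K by rewrite commg_subl.
have ntR : R :!=: 1 by apply: contra nKC => /eqP/commG1P.
have nRA : A \subset 'N(R) by rewrite commg_normr.
have TI : 'C_R(A) = 1 := coprime_abel_cent_TI nKA coKA abK.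
have [W minW sWR] := minnormal_exists ntR nRA.
have [nWA ntW abW] :=
  minnormal_solvable minW sWR (abelian_sol (abelianS sRK abK)).
have [p p_pr abeW] := is_abelemP abW.
exists 'C_A(W)%G; split; first exact: subsetIl.
  have irrW := elimT (abelem_mx_irrP abeW ntW nWA) minW.
  have := center_kquo_cyclic irrW; rewrite rker_abelem.
  suff /center_idP-> : abelian (A / 'C_A(W)) by [].
  exact: quotient_abelian.
apply: contra ntW => sC; rewrite -subG1 -TI subsetI sWR.
apply: subset_trans sC; rewrite subsetI (subset_trans sWR) // centsC.
exact: subsetIr.
Qed.

(** The elements of [A, <x>] are commutators [a, x].  If b <> 1 is one, x and
    hence [A, <x>] centralises C_K(b).  A noncyclic [A, <x>] has a nontrivial
    subgroup whose fixed points on K it does not centralise. *)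
Lemma comm_cycle_cyclic (gT : finGroupType) (G K A : {group gT}) (r : nat) x :
    CPPO G -> K \subset G -> A \subset G -> x \in G ->
    abelian K -> r.-group K -> abelian A -> r^'.-group A ->
    A \subset 'N(K) -> x \in 'N(K) -> x \in 'N(A) -> 'C_A(K) = 1 ->
  cyclic [~: A, <[x]>].
Proof.
move=> cG sKG sAG Gx abK rK abA r'A nKA nKx nAx faithA.
set B := [~: A, <[x]>]%G.
have sBA : B \subset A by rewrite commg_subl cycle_subG.
have [cKB | ncKB] := boolP (K \subset 'C(B)).
  suff -> : B :=: 1 by apply: cyclic1.
  by apply/trivgP; rewrite -faithA subsetI sBA centsC.
have coKB : coprime #|K| #|B| by apply: pnat_coprime rK (pgroupS sBA r'A).
have [||D [sDB cycBD nsC]] := abelian_action_cyclic_quotient _ abK _ coKB ncKB.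
- exact: abelianS abA.
- exact: subset_trans nKA.
have [D1 | /trivgPn[b Db b1]] := eqVneq (gval D) 1.
  by move: cycBD; rewrite D1 -(isog_cyclic (quotient1_isog B)).
case/negP: nsC; have Bb := subsetP sDB b Db.
have [a Aa defb] := comm_cycle_abelian abA nAx Bb.
have Kb : 'C_K[b] \subset 'C(<[a]> <*> <[x]>).
  rewrite defb; apply: (commutator_fixed_points cG sKG abK rK r'A) => //;
    rewrite -?defb //.
  - exact: (subsetP sAG).
  - exact: (subsetP nKA).
  - exact: (subsetP (normG A)).
  - exact: (subsetP sBA).
apply: (@subset_trans _ _ 'C_K[b]);
  first by rewrite setIS // -cent_set1 centS // sub1set.
rewrite centsC; apply: comm_norm_cent_cent.
- by rewrite cycle_subG.
- by rewrite centsC (subset_trans Kb) // centS // joing_subr.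
- suff sAC : A \subset 'C[b] by rewrite normsI // (subset_trans sAC) ?normG.
  rewrite sub_cent1; exact: subsetP abA b (subsetP sBA b Bb).
Qed.

(** The automorphism group of a cyclic group is abelian. *)
Lemma cyclic_action_der1_cent (gT : finGroupType) (B X : {group gT}) :
  cyclic B -> X \subset 'N(B) -> [~: X, X] \subset 'C(B).
Proof.
move=> cycB nBX;
  have nCX : X \subset 'N('C_X(B)) by rewrite normsI ?normG ?norms_cent.
apply: subset_trans (subsetIr X _); apply: der1_min => //.
have : X / 'ker_X (conj_aut B) \isog conj_aut B @* X by apply: first_isog_loc.
rewrite ker_conj_aut => /isog_abelian->.
by apply: abelianS (Aut_cyclic_abelian cycB); apply: Aut_conj_aut.
Qed.

(** * Towers and their minimal configurations *)

(** The elements g of S with [g, t] in D form a t-invariant group that contains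
    all [a, t], hence is S = [S, t]; so [S, t] is contained in D. *)
Lemma comm_comm_stable (gT : finGroupType) (S D : {group gT}) t :
    S \subset 'N(D) -> t \in 'N(D) -> t \in 'N(S) -> [~: S, <[t]>] = S ->
    (forall a, a \in S -> [~ a, t, t] \in D) ->
  S \subset D.
Proof.
move=> nDS nDt nSt defS H.
have gP : group_set [set g in S | [~ g, t] \in D].
  apply/group_setP; split=> [|g h]; first by rewrite inE comm1g !group1.
  rewrite !inE => /andP[Sg Dg] /andP[Sh Dh]; rewrite groupM //= commMgJ.
  by rewrite groupM // memJ_norm // (subsetP nDS).
have sSP : S \subset Group gP.
  rewrite -{1}defS; apply: comm_cycle_sub => [|a Sa].
    rewrite inE; apply/subsetP=> _ /imsetP[g /setIdP[Sg Dg] ->].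
    rewrite inE memJ_norm // Sg /=.
    by rewrite (_ : [~ g ^ t, t] = [~ g, t] ^ t) ?memJ_norm //
      conjRg [t ^ t]conjgE mulKg.
  by rewrite inE H // andbT -defS mem_commg ?cycle_id.
rewrite -defS; apply: comm_cycle_sub => // a Sa.
by have /setIdP[] := subsetP sSP a Sa.
Qed.

(** The form of [commutator_fixed_points] in which S and t generate nothing
    beyond <a, t>. *)
Lemma commutator_fixed_cent (gT : finGroupType) (G A S : {group gT}) a t
    (q : nat) :
    CPPO G -> A \subset G -> S \subset G -> t \in G ->
    abelian A -> q.-group A -> q^'.-group S -> a \in S -> t \in 'N(S) ->
    S \subset 'N(A) -> t \in 'N(A) -> S \subset <[a]> <*> <[t]> ->
    [~ a, t] != 1 ->
  'C_A[[~ a, t]] \subset 'C(S).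
Proof.
move=> cG sAG sSG Gt abA qA q'S Sa nSt nAS nAt genS at1.
apply: subset_trans (centS genS).
apply: (commutator_fixed_points cG sAG abA qA q'S) => //.
- exact: (subsetP sSG).
- exact: (subsetP nAS).
- exact: (subsetP (normG S)).
- by rewrite commgEl groupM ?groupV // memJ_norm.
Qed.

(** K, Q, S and t form the configuration that a group with nontrivial third
    nilpotent residual contains: each acts on the previous ones, consecutive
    orders are coprime, and K is the faithful module for Q at the bottom. *)
Record tower (gT : finGroupType) (G K Q S : {group gT}) (t : gT)
    (r q s : nat) : Prop := Tower {
  tower_CPPO : CPPO G;
  tower_KG : K \subset G; tower_QG : Q \subset G; tower_SG : S \subset G;
  tower_tG : t \in G;
  tower_abK : abelian K; tower_rK : r.-group K;
  tower_qQ : q.-group Q; tower_sS : s.-group S;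
  tower_prime : prime q; tower_rq : r != q; tower_sq : s != q;
  tower_s't : s^'.-elt t; tower_NSt : t \in 'N(S);
  tower_NQS : S \subset 'N(Q); tower_NQt : t \in 'N(Q);
  tower_NKQ : Q \subset 'N(K); tower_NKS : S \subset 'N(K);
  tower_NKt : t \in 'N(K);
  tower_faith : 'C_Q(K) = 1
}.

(** What minimality of a tower gives.  By the last field, an element a of S for
    which [a, t] is nontrivial on Q generates S together with its conjugates
    under t. *)
Record tight_tower (gT : finGroupType) (G K Q S : {group gT}) (t : gT)
    (r q s : nat) : Prop := TightTower {
  tight_is_tower :> tower G K Q S t r q s;
  tight_commQ : [~: Q, S] = Q;
  tight_commS : [~: S, <[t]>] = S;
  tight_gen : forall a, a \in S -> [~ a, t] \notin 'C(Q) ->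
    S \subset <[a]> <*> <[t]>
}.

Lemma p_group_p'group (gT : finGroupType) (p1 p2 : nat) (G : {group gT}) :
  p1 != p2 -> p1.-group G -> p2^'.-group G.
Proof.
by move=> ne p1G; apply: (pi_p'nat p1G); rewrite !inE eq_sym.
Qed.

Lemma tight_r'Q (gT : finGroupType) (G K Q S : {group gT}) t r q s :
  tight_tower G K Q S t r q s -> r^'.-group Q.
Proof.
move=> T; apply: p_group_p'group (tower_qQ T); rewrite eq_sym;
  exact: tower_rq T.
Qed.

Lemma tight_q'S (gT : finGroupType) (G K Q S : {group gT}) t r q s :
  tight_tower G K Q S t r q s -> q^'.-group S.
Proof. move=> T; exact: p_group_p'group (tower_sq T) (tower_sS T). Qed.

Lemma tight_coprime (gT : finGroupType) (G K Q S : {group gT}) t r q s :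
  tight_tower G K Q S t r q s -> coprime #|Q| #|S|.
Proof. by move=> T; apply: pnat_coprime (tower_qQ T) (tight_q'S T). Qed.

Lemma tight_comm_mem (gT : finGroupType) (G K Q S : {group gT}) t r q s a :
  tight_tower G K Q S t r q s -> a \in S -> [~ a, t] \in S.
Proof.
by move=> T Sa; rewrite commgEl groupM ?groupV // memJ_norm // (tower_NSt T).
Qed.

(** Let A be an abelian characteristic subgroup of Q and B = [A, S].  Then
    sigma = [a, t] fixes nothing in B, so B = [B, sigma] is cyclic, hence
    centralised by S = [S, t], hence trivial.  Thus S centralises A, and a
    q-group Q = [Q, S] all of whose abelian characteristic subgroups are
    centralised by S is special. *)
Lemma tight_special (gT : finGroupType) (G K Q S : {group gT}) t r q s a :
    tight_tower G K Q S t r q s -> a \in S -> [~ a, t] \notin 'C(Q) ->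
  special Q /\ 'C_Q(S) = 'Z(Q).
Proof.
move=> T Sa; set sg := [~ a, t] => nCsg.
have coQS := tight_coprime T;
  have [[cG sKG sQG sSG Gt abK rK qQ sS _ _ _ _ nSt nQS nQt nKQ nKS nKt faith]
  defQ defS gen] := T.
apply: (abelian_charsimple_special qQ coQS defQ).
apply/bigcupsP=> A /andP[chA abA].
have sAQ := char_sub chA.
have nAS : S \subset 'N(A) := char_norm_trans chA nQS.
have nAt : t \in 'N(A)
  by rewrite -cycle_subG (char_norm_trans chA) // cycle_subG.
have Ssg : sg \in S := tight_comm_mem T Sa.
have sg1 : sg != 1 by apply: contraNneq nCsg => ->; rewrite group1.
pose B := [~: A, S]%G.
have sBA : B \subset A by rewrite commg_subl.
have sBQ := subset_trans sBA sAQ.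
have abB := abelianS sBA abA.
have nBS : S \subset 'N(B) by rewrite commg_normr.
have nBt : t \in 'N(B) by rewrite -cycle_subG normsR // cycle_subG.
have coAS : coprime #|A| #|S| := coprimeSg sAQ coQS.
have TI : 'C_B(S) = 1 by apply: coprime_abel_cent_TI.
have sB : 'C_B[sg] \subset 'C(S).
  apply: (commutator_fixed_cent cG _ sSG Gt abB (pgroupS sBQ qQ) (tight_q'S T)
    Sa) => //.
    exact: subset_trans sQG.
  exact: gen.
have nBsg : <[sg]> \subset 'N(B) by rewrite cycle_subG (subsetP nBS).
have coBsg : coprime #|B| #|<[sg]>|.
  by apply: coprimegS (coprimeSg sBQ coQS); rewrite cycle_subG.
have cycB : cyclic B.
  rewrite -(coprime_comm_cent_prod (abelian_sol abB) nBsg coBsg).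
  have -> : 'C_B(<[sg]>) = 1.
    by apply/trivgP; rewrite -TI /= cent_cycle subsetI subsetIl.
  rewrite mulg1.
  apply: (comm_cycle_cyclic cG sKG _ _ abK rK abB (pgroupS sBQ (tight_r'Q T))).
  - exact: subset_trans sQG.
  - exact: (subsetP sSG).
  - exact: subset_trans nKQ.
  - exact: (subsetP nKS).
  - exact: (subsetP nBS).
  - by apply/trivgP; rewrite -faith setSI.
have cSB : S \subset 'C(B).
  rewrite -defS;
    apply: subset_trans (cyclic_action_der1_cent cycB (_ : S <*> <[t]> \subset
    _)).
    by rewrite commgSS ?joing_subl ?joing_subr.
  by rewrite join_subG nBS cycle_subG.
have B1 : B :=: 1 by apply/trivgP; rewrite -TI subsetI subxx centsC.
by apply/commG1P.
Qed.

Lemma tight_nonabelian (gT : finGroupType) (G K Q S : {group gT}) t r q s a :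
    tight_tower G K Q S t r q s -> a \in S -> [~ a, t] \notin 'C(Q) ->
  ~~ abelian Q.
Proof.
move=> T Sa nC; have [_ cQS] := tight_special T Sa nC.
apply: contra nC => /center_idP ZQ; apply: subsetP (tight_comm_mem T Sa).
by rewrite centsC; rewrite ZQ in cQS; rewrite -cQS subsetIr.
Qed.

(** The computation on commutators applies to the section Q / Z(Q) as well: a
    fixed point of sigma is fixed by S, and C_Q(S) = Z(Q). *)
Lemma tight_quotient_fix (gT : finGroupType) (G K Q S : {group gT}) t r q s a :
    tight_tower G K Q S t r q s -> a \in S -> [~ a, t] \notin 'C(Q) ->
  'C_(Q / 'Z(Q))[coset 'Z(Q) [~ a, t]] = 1.
Proof.
move=> T Sa; set sg := [~ a, t] => nCsg.
have [spQ cQS] := tight_special T Sa nCsg.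
have coQS := tight_coprime T;
  have [[cG sKG sQG sSG Gt abK rK qQ sS _ _ _ _ nSt nQS nQt nKQ nKS nKt faith]
  defQ defS gen] := T.
set Z := 'Z(Q)%G.
have chZ : Z \char Q := center_char Q.
have nZS : S \subset 'N(Z) := char_norm_trans chZ nQS.
have nZt : t \in 'N(Z)
  by rewrite -cycle_subG (char_norm_trans chZ) // cycle_subG.
have nZa := subsetP nZS a Sa.
have Ssg : sg \in S := tight_comm_mem T Sa.
have sg1 : sg != 1 by apply: contraNneq nCsg => ->; rewrite group1.
have sgZ1 : coset Z sg != 1.
  apply: contra sg1 => /eqP/(coset_idr (subsetP nZS sg Ssg)) Zsg.
  have : sg \in Q :&: S by rewrite inE Ssg (subsetP (center_sub Q)).
  by rewrite (coprime_TIg coQS) inE.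
have TI : 'C_(Q / Z)(S / Z) = 1.
  rewrite -coprime_quotient_cent ?center_sub ?(pgroup_sol qQ) //.
  by rewrite cQS trivg_quotient.
apply/trivgP; rewrite -TI subsetI subsetIl /= /sg morphR //.
apply: (@commutator_fixed_cent _ (G / Z)%G _ _ _ _ q).
- exact: CPPO_quotient.
- exact: quotientS.
- exact: quotientS.
- exact: mem_quotient.
- by apply: sub_der1_abelian; have [_ /= ->] := spQ.
- exact: quotient_pgroup.
- apply: quotient_pgroup; exact: tight_q'S T.
- exact: mem_quotient.
- rewrite -cycle_subG -quotient_cycle // quotient_norms // cycle_subG //.
- exact: quotient_norms.
- rewrite -cycle_subG -quotient_cycle // quotient_norms // cycle_subG //.
- rewrite -!quotient_cycle // -quotientY ?cycle_subG //; apply: quotientS;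
    exact: gen.
- by rewrite -morphR.
Qed.

Lemma tight_cent_center (gT : finGroupType) (G K Q S : {group gT}) t r q s a :
    tight_tower G K Q S t r q s -> a \in S -> [~ a, t] \notin 'C(Q) ->
  S \subset 'C('Z(Q)).
Proof.
by move=> T Sa nC; have [_ <-] := tight_special T Sa nC;
  rewrite centsC subsetIr.
Qed.

Lemma tight_norm_center (gT : finGroupType) (G K Q S : {group gT}) t r q s :
  tight_tower G K Q S t r q s -> S <*> <[t]> \subset 'N('Z(Q)).
Proof.
move=> T; apply: char_norm_trans (center_char Q) _.
by rewrite join_subG cycle_subG (tower_NQS T) (tower_NQt T).
Qed.

Lemma tight_central_of_comm (gT : finGroupType) (G K Q S : {group gT}) t r q s a
    u :
    tight_tower G K Q S t r q s -> a \in S -> [~ a, t] \notin 'C(Q) ->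
  u \in Q -> [~ u, [~ a, t]] \in 'Z(Q) -> u \in 'Z(Q).
Proof.
move=> T Sa nC Qu Zu; have Ssg := tight_comm_mem T Sa.
have nZu : u \in 'N('Z(Q)) by apply: subsetP Qu;
  apply: normal_norm (center_normal Q).
have nZs : [~ a, t] \in 'N('Z(Q)).
  by apply: (subsetP (tight_norm_center T)); rewrite mem_gen // inE Ssg.
apply: coset_idr => //.
suff : coset 'Z(Q) u \in 'C_(Q / 'Z(Q))[coset 'Z(Q) [~ a, t]].
  by rewrite (tight_quotient_fix T Sa nC) => /set1P.
by rewrite inE mem_quotient //=; apply/cent1P/commgP;
  rewrite -morphR //= coset_id.
Qed.

(** Commutation with sigma is injective on Q / Z(Q), therefore surjective. *)
Lemma tight_comm_surj (gT : finGroupType) (G K Q S : {group gT}) t r q s a v :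
    tight_tower G K Q S t r q s -> a \in S -> [~ a, t] \notin 'C(Q) ->
    v \in Q ->
  exists2 u, u \in Q & exists2 z, z \in 'Z(Q) & v = [~ u, [~ a, t]] * z.
Proof.
move=> T Sa; set sg := [~ a, t] => nC Qv; have Ssg := tight_comm_mem T Sa.
have [spQ _] := tight_special T Sa nC.
have nZQ : Q \subset 'N('Z(Q)) := normal_norm (center_normal Q).
have nZs : sg \in 'N('Z(Q)).
  by apply: (subsetP (tight_norm_center T)); rewrite mem_gen // inE Ssg.
have nQs : sg \in 'N(Q) := subsetP (tower_NQS T) sg Ssg.
set V := (Q / 'Z(Q))%G; set sb := coset 'Z(Q) sg.
have abV : abelian V by apply: sub_der1_abelian; have [_ /= ->] := spQ.
have nVs : <[sb]> \subset 'N(V)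
  by rewrite -quotient_cycle // quotient_norms // cycle_subG.
have coV : coprime #|V| #|<[sb]>|.
  rewrite -quotient_cycle // coprime_morph //.
  by apply: coprimegS (tight_coprime T); rewrite cycle_subG.
have defV : [~: V, <[sb]>] = V.
  rewrite -[RHS](coprime_comm_cent_prod (abelian_sol abV) nVs coV) /=.
  by rewrite cent_cycle (tight_quotient_fix T Sa nC) mulg1.
have : coset 'Z(Q) v \in [~: V, <[sb]>] by rewrite defV mem_quotient.
case/(comm_cycle_abelian abV) => [|w /morphimP[u Nu Qu ->] Ev];
  first by rewrite -cycle_subG.
exists u => //; exists ([~ u, sg]^-1 * v); last by rewrite mulKVg.
have Qus : [~ u, sg] \in Q by rewrite commgEl groupM ?groupV // memJ_norm.
apply: coset_idr; first by rewrite groupM ?groupV // (subsetP nZQ).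
have nZus : [~ u, sg] \in 'N('Z(Q)) := subsetP nZQ _ Qus.
rewrite morphM ?morphV ?groupV ?(subsetP nZQ) //= (_ : coset _ v = coset 'Z(Q)
  [~ u, sg]) ?mulVg //.
by rewrite morphR.
Qed.

Lemma tight_comm_cent (gT : finGroupType) (G K Q S : {group gT}) t r q s a u :
    tight_tower G K Q S t r q s -> a \in S -> u \in Q -> [~ u, [~ a, t]] != 1 ->
  'C_K[[~ u, [~ a, t]]] \subset 'C(<[u]> <*> <[[~ a, t]]>).
Proof.
move=> T Sa Qu h1; have Ssg := tight_comm_mem T Sa.
have nQs : [~ a, t] \in 'N(Q) := subsetP (tower_NQS T) _ Ssg.
apply: (commutator_fixed_points (tower_CPPO T) (tower_KG T) (tower_abK T)
  (tower_rK T) (tight_r'Q T)) => //.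
- exact: subsetP (tower_QG T) u Qu.
- exact: subsetP (tower_SG T) _ Ssg.
- exact: subsetP (tower_NKQ T) u Qu.
- exact: subsetP (tower_NKS T) _ Ssg.
- exact: subsetP (normG Q) u Qu.
- by rewrite commgEl groupM ?groupV // memJ_norm.
Qed.

Lemma tight_exp_center (gT : finGroupType) (G K Q S : {group gT}) t r q s a u :
    tight_tower G K Q S t r q s -> a \in S -> [~ a, t] \notin 'C(Q) ->
    u \in Q ->
  u ^+ q \in 'Z(Q).
Proof.
move=> T Sa nC Qu; have [[ZQ ZQ'] _] := tight_special T Sa nC.
rewrite -ZQ (Phi_joing (tower_qQ T)) mem_gen // inE; apply/orP; right.
by rewrite (Mho_p_elt 1) // (mem_p_elt (tower_qQ T)).
Qed.

(** Q has class 2 and u^q is central, hence fixed by sigma; the correction term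
    has exponent q (q - 1) / 2, a multiple of q. *)
Lemma tight_comm_exp (gT : finGroupType) (G K Q S : {group gT}) t r q s a u :
    tight_tower G K Q S t r q s -> a \in S -> [~ a, t] \notin 'C(Q) ->
    u \in Q ->
  odd q -> [~ u, [~ a, t]] ^+ q = 1.
Proof.
move=> T Sa; set sg := [~ a, t] => nC Qu oddq; have Ssg := tight_comm_mem T Sa.
have [[ZQ ZQ'] cQS] := tight_special T Sa nC.
have nQs : sg \in 'N(Q) := subsetP (tower_NQS T) sg Ssg.
have Qus : u ^ sg \in Q by rewrite memJ_norm.
have Zc : [~ u ^ sg, u^-1] \in 'Z(Q) by rewrite -ZQ' mem_commg // groupV.
have cZ g : g \in Q -> commute g [~ u ^ sg, u^-1].
  by move=> Qg; have /setIP[_ /centP/(_ g Qg)/commute_sym] := Zc.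
rewrite commgEl expMg_Rmul; [|exact: cZ|by apply: cZ; rewrite groupV].
have abZ := center_special_abelem (tower_qQ T) (conj ZQ ZQ').
have expZ z : z \in 'Z(Q) -> z ^+ q = 1 by move=> Zz; have /abelemP[] := abZ;
  first exact: (tower_prime T); move=> _; apply.
have -> : [~ u ^ sg, u^-1] ^+ 'C(q, 2) = 1.
  by rewrite bin2odd // expgM expZ // expg1n.
rewrite mulg1 -conjXg expgVn -commgEl; apply/eqP/commgP.
have Zuq := tight_exp_center T Sa nC Qu.
by apply/commute_sym/(centsP (tight_cent_center T Sa nC)).
Qed.

(** * Odd primes: the action is scalar *)

(** An automorphism of an elementary abelian group that preserves every cyclic
    subgroup is a scalar, hence commutes with all automorphisms. *)
Lemma power_action_cent (gT : finGroupType) (V : {group gT}) p g x :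
    prime p -> p.-abelem V -> x \in 'N(V) ->
    (forall v, v \in V -> v ^ g \in <[v]>) ->
  [~ g, x] \in 'C(V).
Proof.
move=> p_pr abeV nVx pw; have [abV expV] := abelemP p_pr abeV.
have [k Hk] : exists k, forall v, v \in V -> v ^ g = v ^+ k.
  have [V1 | /trivgPn[v0 Vv0 v01]] := eqVneq (gval V) 1.
    by exists 1%N => v; rewrite V1 => /set1P->; rewrite conj1g expg1n.
  have ord v : v \in V -> v != 1 -> #[v] = p.
    by move=> Vv v1; apply: abelem_order_p abeV Vv v1.
  have /cycleP[k Hk] := pw v0 Vv0; exists k => w Vw.
  have [/cycleP[i ->] | w_v0] := boolP (w \in <[v0]>).
    by rewrite conjXg Hk -!expgM mulnC.
  have w1 : w != 1 by apply: contraNneq w_v0 => ->; rewrite group1.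
  have /cycleP[l Hl] := pw w Vw.
  have /cycleP[m Hm] := pw (v0 * w) (groupM Vv0 Vw).
  have cvw : commute v0 w by apply: (centsP abV).
  have TI : <[v0]> :&: <[w]> = 1.
    by rewrite setIC prime_TIg ?cycle_subG // -orderE ord.
  have E : (v0 ^+ m)^-1 * v0 ^+ k = w ^+ m * (w ^+ l)^-1.
    move: Hm; rewrite conjMg Hk Hl expgMn // => Hm.
    by apply: (canRL (mulgK _)); rewrite -mulgA Hm mulKg.
  have E1 : (v0 ^+ m)^-1 * v0 ^+ k = 1.
    apply/set1P; rewrite -[[set 1]]TI inE groupM ?groupV ?mem_cycle //=.
    by rewrite E groupM ?groupV ?mem_cycle.
  have /eqP : v0 ^+ m = v0 ^+ k by rewrite -[RHS](mulKVg (v0 ^+ m)) E1 mulg1.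
  rewrite eq_expg_mod_order ord // -(ord w) // -eq_expg_mod_order => /eqP <-.
  by rewrite Hl -[LHS]mul1g -E1 E mulgKV.
have cgx v : v \in V -> v ^ (g * x) = v ^ (x * g).
  by move=> Vv; rewrite !conjgM Hk // conjXg Hk // memJ_norm.
apply/centP=> v Vv; apply/commute_sym/commgP/conjg_fixP.
have -> : [~ g, x] = (x * g)^-1 * (g * x) by group_id.
have Vv' : v ^ (x * g)^-1 \in V.
  have nVg : g \in 'N(V).
    by rewrite inE; apply/subsetP=> _ /imsetP[w Vw ->]; rewrite Hk ?groupX.
  by rewrite memJ_norm // groupV groupM.
by rewrite conjgM cgx // conjgKV.
Qed.

(** Put h = [u, sigma] and suppose that z = [h, b] is nontrivial.  Fixed points
    of h on K are fixed by u and sigma, hence by z, so neither z nor h fixes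
    anything nontrivial in K1 = [K, z].  All nontrivial elements of
    E = <h, z> generate the same subgroup as z or as a conjugate of h under <b>,
    so E acts on K1 without fixed points.  But E is elementary abelian of order
    q^2. *)
Lemma tight_comm_commute (gT : finGroupType) (G K Q S : {group gT}) t r q s a u
    b :
    tight_tower G K Q S t r q s -> a \in S -> [~ a, t] \notin 'C(Q) ->
    u \in Q ->
    odd q -> b \in Q -> b \in <[u]> <*> <[[~ a, t]]> ->
  commute [~ u, [~ a, t]] b.
Proof.
move=> T Sa; set sg := [~ a, t]; set h := [~ u, sg] => nC Qu oddq Qb Lb.
have Ssg := tight_comm_mem T Sa; have [[ZQ ZQ'] cQS] := tight_special T Sa nC.
have nQs : sg \in 'N(Q) := subsetP (tower_NQS T) sg Ssg.
have Qh : h \in Q by rewrite /h commgEl groupM ?groupV // memJ_norm.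
apply/commgP/negPn/negP=> z1; set z := [~ h, b] in z1.
have Zz : z \in 'Z(Q) by rewrite -ZQ' mem_commg.
have abelZ := center_special_abelem (tower_qQ T) (conj ZQ ZQ').
have q_pr := tower_prime T; have abK := tower_abK T.
have oz : #[z] = q by apply: abelem_order_p abelZ Zz z1.
have h1 : h != 1 by apply: contraNneq z1 => h1; rewrite /z h1 comm1g.
have hq : h ^+ q = 1 := tight_comm_exp T Sa nC Qu oddq.
have cz g : g \in Q -> commute g z.
  by move=> Qg; have /setIP[_ /centP/(_ g Qg)/commute_sym] := Zz.
have Qz : z \in Q := subsetP (center_sub Q) z Zz.
have Lh : h \in <[u]> <*> <[sg]>
  by rewrite groupR // mem_gen // inE cycle_id ?orbT.
have Lz : z \in <[u]> <*> <[sg]> by rewrite groupR.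
have nKQ := tower_NKQ T.
have nKz : z \in 'N(K) := subsetP nKQ z Qz.
set K1 := [~: K, <[z]>]%G.
have sK1 : K1 \subset K by rewrite commg_subl cycle_subG.
have TI k : k \in K1 -> commute k z -> k = 1.
  move=> K1k ckz; have C1 : 'C_K1(<[z]>) = 1.
    apply: coprime_abel_cent_TI; rewrite ?cycle_subG //.
    by apply: pnat_coprime (tower_rK T) (mem_p_elt (tight_r'Q T) Qz).
  by apply/set1P; rewrite -[[set 1]]C1 cent_cycle inE K1k; apply/cent1P.
have nK1 g : g \in Q -> g \in 'N(K1).
  move=> Qg; rewrite -cycle_subG normsR // cycle_subG ?(subsetP nKQ) //.
  by apply: (subsetP (cent_sub _)); rewrite cent_cycle; apply/cent1P/cz.
have TIh k : k \in K1 -> commute k h -> k = 1.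
  move=> K1k ckh; apply: TI => //.
  have : k \in 'C_K[h] by rewrite inE (subsetP sK1); first apply/cent1P.
  by move/(subsetP (tight_comm_cent T Sa Qu h1))/centP; apply.
(* A nontrivial h^i z^j generates either <z>, or a conjugate of <h> because
   h^(b^l) = h z^l. *)
have TIe i j k : k \in K1 -> commute k (h ^+ i * z ^+ j) ->
  h ^+ i * z ^+ j != 1 -> k = 1.
  move=> K1k ck ne.
  have czh : commute (h ^+ i) (z ^+ j)
    by apply/commuteX/commute_sym/commuteX/commute_sym/cz.
  have [hi1 | hi1] := eqVneq (h ^+ i) 1.
    rewrite hi1 mul1g in ck ne; apply: TI => //.
    have co : coprime q j.
      rewrite prime_coprime //; apply: contra ne => /dvdnP[m ->].
      by rewrite mulnC expgM -oz expg_order expg1n.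
    have [m Em] : exists m, z = z ^+ j ^+ m.
      have : z \in <[z ^+ j]>.
        have : generator <[z]> (z ^+ j) by rewrite generator_coprime oz.
        by move/eqP=> <-; rewrite cycle_id.
      by case/cycleP=> m Em; exists m.
    by rewrite Em; apply: commuteX.
  have co : coprime q i.
    rewrite prime_coprime //; apply: contra hi1 => /dvdnP[m ->].
    by rewrite mulnC expgM hq expg1n.
  have [m Em] : exists m, h = h ^+ i ^+ m.
    have : h \in <[h ^+ i]>.
      have : generator <[h]> (h ^+ i).
        by rewrite generator_coprime; apply: coprime_dvdl co;
          rewrite order_dvdn hq.
      by move/eqP=> <-; rewrite cycle_id.
    by case/cycleP=> m Em; exists m.
  pose l := (j * m)%N.
  have ckl : commute k (h ^ (b ^+ l)).
    have -> : h ^ (b ^+ l) = (h ^+ i * z ^+ j) ^+ m; last exact: commuteX.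
    rewrite expgMn // -Em -expgM -/l conjg_mulR; congr (_ * _).
    by rewrite commgX //; apply: cz.
  have Qbl : b ^+ l \in Q by rewrite groupX.
  suff : k ^ (b ^+ l)^-1 = 1 by move/eqP; rewrite conjg_eq1 => /eqP.
  apply: TIh; first by rewrite memJ_norm // groupV nK1.
  by apply/commgP; rewrite -(conjg_eq1 _ (b ^+ l)) conjRg conjgKV; apply/commgP.
set E := <[h]> <*> <[z]>.
have chz : <[z]> \subset 'C(<[h]>) by rewrite cent_cycle cycle_subG;
  apply/cent1P; exact: (commute_sym (cz h Qh)).
have defE : E = <[h]> * <[z]> := cent_joinEr chz.
have abE : abelian E by rewrite /E abelianY !cycle_abelian.
have sEQ : E \subset Q by rewrite join_subG !cycle_subG Qh.
have K1nt : K1 :!=: 1.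
  apply: contra z1 => /eqP/commG1P; rewrite cent_cycle => cKz.
  rewrite -[_ == _]/(z == 1); apply/eqP/set1P;
    rewrite -[[set 1]](tower_faith T).
  by rewrite inE Qz -sub_cent1.
have nK1E : E \subset 'N(K1) by apply/subsetP=> g Eg; apply/nK1/(subsetP sEQ).
have coK1E : coprime #|K1| #|E|.
  by apply: pnat_coprime (pgroupS sK1 (tower_rK T)) (pgroupS sEQ (tight_r'Q T)).
have nC1 : ~~ (K1 \subset 'C(E)).
  apply: contra K1nt => cKE; rewrite -subG1; apply/subsetP=> k K1k;
    apply/set1P/TI => //.
  by apply: (centP (subsetP cKE k K1k)); rewrite mem_gen // inE cycle_id orbT.
have [B [sBE cycEB]] :=
  abelian_action_cyclic_quotient abE (abelianS sK1 abK) nK1E coK1E nC1.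
have [B1 _ | /trivgPn[e Be e1]] := eqVneq (gval B) 1; last first.
  case/negP; apply/subsetP=> k /setIP[K1k /centP/(_ e Be) cke].
  have : e \in <[h]> * <[z]> by rewrite -defE (subsetP sBE).
  case/mulsgP=> [_ _ /cycleP[i ->] /cycleP[j ->] Ee].
  by rewrite (TIe i j k) ?group1 // -Ee.
have cycE : cyclic E by move: cycEB;
  rewrite B1 -(isog_cyclic (quotient1_isog _)).
have abelE : q.-abelem E.
  apply/abelemP=> //; split=> // g Eg.
  have : g \in <[h]> * <[z]> by rewrite -defE.
  case/mulsgP=> _ _ /cycleP[i ->] /cycleP[j ->] ->.
  rewrite expgMn; last by apply/commuteX/commute_sym/commuteX/commute_sym/cz.
  by rewrite -!expgM ![(_ * q)%N]mulnC !expgM hq -oz expg_order !expg1n mulg1.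
have oE : #|E| = q.
  apply: cyclic_abelem_prime abelE cycE _; apply: contraNneq z1 => E1.
  by rewrite -[_ == _]/(z == 1); apply/eqP/set1P;
    rewrite -[[set 1]]E1 mem_gen // inE cycle_id orbT.
have EE : <[z]> = E.
  by apply/eqP; rewrite eqEcard joing_subr [#|<[z]>|]oz oE leqnn.
have /cycleP[m Em] : h \in <[z]> by rewrite EE mem_gen // inE cycle_id.
case/negP: z1; apply/commgP; rewrite Em; apply/commute_sym/commuteX; exact: cz.
Qed.

(** Write an element of Q / Z(Q) as the coset of h = [u, sigma].  The group A
    generated by the sigma-conjugates of h is abelian, [A, sigma] is cyclic, and
    A = [A, sigma] C_A(sigma) with C_A(sigma) central; so sigma preserves the
    cyclic subgroup generated by the coset of h. *)
Lemma tight_power_action (gT : finGroupType) (G K Q S : {group gT}) t r q s a :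
    tight_tower G K Q S t r q s -> a \in S -> [~ a, t] \notin 'C(Q) -> odd q ->
  forall v, v \in Q / 'Z(Q) -> v ^ coset 'Z(Q) [~ a, t] \in <[v]>.
Proof.
move=> T Sa; set sg := [~ a, t] => nC oddq _ /morphimP[v0 _ Qv0 ->].
have [u Qu [z Zz ->]] := tight_comm_surj T Sa nC Qv0; rewrite -/sg.
set h := [~ u, sg]; have Ssg := tight_comm_mem T Sa.
have nZQ : Q \subset 'N('Z(Q)) := normal_norm (center_normal Q).
have nZs : sg \in 'N('Z(Q)).
  by apply: (subsetP (tight_norm_center T)); rewrite mem_gen // inE Ssg.
have nQs : sg \in 'N(Q) := subsetP (tower_NQS T) sg Ssg.
have Qh : h \in Q by rewrite /h commgEl groupM ?groupV // memJ_norm.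
have -> : coset_morphism 'Z(Q) (h * z) = coset 'Z(Q) h.
  rewrite morphM ?(subsetP nZQ) ?(subsetP (center_sub Q) z) //=.
  by rewrite [coset _ z]coset_id ?mulg1.
have Lsg : sg \in <[u]> <*> <[sg]> by rewrite mem_gen // inE cycle_id orbT.
have Lh : h \in <[u]> <*> <[sg]> by rewrite groupR // mem_gen // inE cycle_id.
set A := << h ^: <[sg]> >>%G.
have hA : h \in A by rewrite mem_gen // class_refl.
have sAQ : A \subset Q.
  by rewrite gen_subG class_sub_norm ?cycle_subG.
have nAs : sg \in 'N(A).
  by rewrite -cycle_subG norms_gen // class_norm.
have ch i : commute h (h ^ (sg ^+ i)).
  apply: (tight_comm_commute T) => //; first by rewrite memJ_norm // groupX.
  by rewrite groupJ // groupX.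
have abA : abelian A.
  rewrite abelian_gen;
    apply/centsP=> _ /imsetP[x /cycleP[i ->] ->] _ /imsetP[y /cycleP[j ->] ->].
  wlog le_ij : i j / i <= j.
    by move=> W; case/orP: (leq_total i j) => /W //; apply: commute_sym.
  apply/commgP; rewrite -(subnK le_ij) expgD conjgM -conjRg conjg_eq1;
    exact/commgP.
have cyc : cyclic [~: A, <[sg]>].
  apply: (comm_cycle_cyclic (tower_CPPO T) (tower_KG T) _ _ (tower_abK T)
    (tower_rK T) abA).
  - exact: subset_trans (tower_QG T).
  - exact: (subsetP (tower_SG T)).
  - exact: pgroupS sAQ (tight_r'Q T).
  - exact: subset_trans (tower_NKQ T).
  - exact: (subsetP (tower_NKS T)).
  - exact: nAs.
  - by apply/trivgP; rewrite -(tower_faith T) setSI.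
have coA : coprime #|A| #|<[sg]>|.
  by apply: (coprimeSg sAQ); apply: coprimegS (tight_coprime T);
    rewrite cycle_subG.
have := hA; rewrite -(coprime_comm_cent_prod (abelian_sol abA) _ coA)
  ?cycle_subG //.
case/mulsgP=> x w Rx; rewrite cent_cycle => /setIP[Aw /cent1P cw] Eh.
have Qw := subsetP sAQ w Aw.
have Zw : w \in 'Z(Q).
  apply: (tight_central_of_comm T Sa nC Qw); rewrite -/sg.
  have -> : [~ w, sg] = 1 by apply/eqP/commgP.
  exact: group1.
have nRs : sg \in 'N([~: A, <[sg]>]) by rewrite -cycle_subG commg_normr.
have xs : x ^ sg \in <[x]>.
  have chx : <[x]> \char [~: A, <[sg]>] by rewrite sub_cyclic_char ?cycle_subG.
  rewrite memJ_norm ?cycle_id // -cycle_subG.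
  by apply: char_norm_trans chx _; rewrite cycle_subG.
have Qx : x \in Q by apply: (subsetP sAQ); apply: subsetP Rx;
  rewrite commg_subl cycle_subG.
have Ehx : coset 'Z(Q) h = coset 'Z(Q) x.
  by rewrite Eh morphM ?(subsetP nZQ) //= [coset _ w]coset_id ?mulg1.
rewrite Ehx -morphJ ?(subsetP nZQ x) //=.
by rewrite -quotient_cycle ?(subsetP nZQ) // mem_quotient.
Qed.

(** Otherwise [b, t, t] would act trivially on V for all b in S, so S = [S, t]
    would centralise V, against [tight_quotient_fix]. *)
Lemma tight_noncommuting (gT : finGroupType) (G K Q S : {group gT}) t r q s a :
    tight_tower G K Q S t r q s -> a \in S -> [~ a, t] \notin 'C(Q) ->
  ~ forall b, b \in S -> [~ b, t] \notin 'C(Q) ->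
      [~ coset 'Z(Q) [~ b, t], coset 'Z(Q) t] \in 'C(Q / 'Z(Q)).
Proof.
move=> T Sa nC H; have sNZ := tight_norm_center T.
have nZS : S \subset 'N('Z(Q)) by apply: subset_trans sNZ; rewrite joing_subl.
have nZt : t \in 'N('Z(Q)) by apply: (subsetP sNZ);
  rewrite mem_gen // inE cycle_id orbT.
set V := (Q / 'Z(Q))%G.
have nVS : S / 'Z(Q) \subset 'N(V) by rewrite quotient_norms // (tower_NQS T).
have nVt : coset 'Z(Q) t \in 'N(V).
  by rewrite -cycle_subG -quotient_cycle // quotient_norms //
    cycle_subG (tower_NQt T).
have sSC : S / 'Z(Q) \subset 'C(V).
  apply: (@comm_comm_stable _ _ _ (coset 'Z(Q) t)).
  - exact: subset_trans (norms_cent nVS) _.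
  - by rewrite -cycle_subG norms_cent // cycle_subG.
  - by rewrite -cycle_subG -quotient_cycle // quotient_norms //
      cycle_subG (tower_NSt T).
  - by rewrite -quotient_cycle // -quotientR ?cycle_subG // (tight_commS T).
  move=> _ /morphimP[b nZb Sb ->].
  rewrite -!morphR //=; last by rewrite groupR.
  have Sbt := tight_comm_mem T Sb.
  have nZbt := subsetP nZS _ Sbt.
  have [cbt | ncbt] := boolP ([~ b, t] \in 'C(Q)).
    have cV : coset 'Z(Q) [~ b, t] \in 'C(V).
      by rewrite (subsetP (morphim_cent _ _)) // mem_quotient.
    rewrite morphR //= commgEl groupM ?groupV // memJ_norm //.
    by rewrite -cycle_subG norms_cent // cycle_subG.
  by rewrite morphR //=; apply: H.
have V1 : V :=: 1.
  apply/trivgP; rewrite /= -(tight_quotient_fix T Sa nC) subsetI subxx /=.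
  rewrite sub_cent1 (subsetP sSC) // mem_quotient //;
    exact: tight_comm_mem T Sa.
case/negP: (tight_nonabelian T Sa nC); apply/center_idP/eqP.
rewrite eqEsubset center_sub -quotient_sub1 ?normal_norm ?center_normal //.
by move: V1 => /= ->.
Qed.

Lemma tight_even (gT : finGroupType) (G K Q S : {group gT}) t r q s a :
    tight_tower G K Q S t r q s -> a \in S -> [~ a, t] \notin 'C(Q) -> q = 2.
Proof.
move=> T Sa nC; case: (even_prime (tower_prime T)) => // oddq.
case: (tight_noncommuting T Sa nC) => b Sb nCb.
have [[ZQ _] _] := tight_special T Sa nC.
have abelV : q.-abelem (Q / 'Z(Q))
  by rewrite -ZQ Phi_quotient_abelem ?(tower_qQ T).
apply: (power_action_cent (tower_prime T) abelV).
  have nZt : t \in 'N('Z(Q)) by apply: (subsetP (tight_norm_center T));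
    rewrite mem_gen // inE cycle_id orbT.
  by rewrite -cycle_subG -quotient_cycle // quotient_norms //
    cycle_subG (tower_NQt T).
exact: (tight_power_action T).
Qed.

(** * The prime 2: the action on a four-group *)

(** The hypothesis on products says that V has at most three nontrivial
    elements.  A fixed-point-free automorphism permutes them in a 3-cycle, and
    3-cycles on three letters commute. *)
Lemma four_group_cent (gT : finGroupType) (V : {group gT}) g t :
    2.-abelem V -> g \in 'N(V) -> t \in 'N(V) ->
    (forall v w x, v \in V -> w \in V -> x \in V -> v != 1 -> w != 1 ->
    x != 1 ->
       v * w != 1 -> v * x != 1 -> w * x != 1 -> v * w * x = 1) ->
    (forall v, v \in V -> v ^ g = v -> v = 1) ->
    (forall v, v \in V -> v ^ t = v -> v = 1) ->
  [~ g, t] \in 'C(V).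
Proof.
move=> abelV nVg nVt four fixg fixt.
have [abV expV] := abelemP (isT : prime 2) abelV.
have inv v : v \in V -> v * v = 1 by move=> Vv; apply: expV.
have mul1 v w : v \in V -> w \in V -> (v * w == 1) = (v == w).
  move=> Vv Vw; rewrite -eq_invg_mul.
  by have /eqP-> : v^-1 == v by rewrite eq_invg_mul inv.
(* v, v^h and their product exhaust the nontrivial elements of V. *)
have cyc h v : h \in 'N(V) -> (forall v, v \in V -> v ^ h = v -> v = 1) ->
    v \in V -> v != 1 -> (v ^ h) ^ h = v * v ^ h.
  move=> nVh fixh Vv v1; set w := v ^ h.
  have Vw : w \in V by rewrite memJ_norm.
  have w1 : w != 1 by rewrite conjg_eq1.
  have wv : w != v by apply: contraNneq v1 => /(fixh v Vv)->.
  have Vx : w ^ h \in V by rewrite memJ_norm.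
  have x1 : w ^ h != 1 by rewrite conjg_eq1.
  have xw : w ^ h != w by apply: contraNneq w1 => /(fixh w Vw)->.
  have xv : w ^ h != v.
    apply: contraNneq wv => xv; have : v * w = 1.
      apply: fixh; first exact: groupM.
      rewrite conjMg xv -/w; exact: (centsP abV).
    by move/eqP; rewrite mul1 // eq_sym.
  have /eqP : v * w * w ^ h = 1.
    by apply: four => //; rewrite mul1 // eq_sym.
  by rewrite -/w (mul1 _ _ (groupM Vv Vw) Vx) => /eqP->.
have comm v : v \in V -> v ^ (g * t) = v ^ (t * g).
  move=> Vv; have [-> | v1] := eqVneq v 1; first by rewrite !conj1g.
  rewrite !conjgM; have Vg : v ^ g \in V by rewrite memJ_norm.
  have Vt : v ^ t \in V by rewrite memJ_norm.
  have vg1 : v ^ g != 1 by rewrite conjg_eq1.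
  have vt1 : v ^ t != 1 by rewrite conjg_eq1.
  have [E | ne] := eqVneq (v ^ g) (v ^ t).
    by rewrite E -{2}E !cyc // E.
  have E : v ^ g = v * v ^ t.
    have /eqP : v * v ^ t * v ^ g = 1.
      apply: four => //; rewrite mul1 // eq_sym //.
      - by apply: contraNneq v1 => /(fixt v Vv)->.
      - by apply: contraNneq v1 => /(fixg v Vv)->.
    by rewrite (mul1 _ _ (groupM Vv Vt) Vg) => /eqP->.
  have swap x y : x \in V -> y \in V -> x * (y * x) = y.
    by move=> Vx Vy; rewrite (centsP abV y Vy x Vx) mulgA inv ?mul1g.
  have Et : v ^ t = v * v ^ g by rewrite E mulgA inv // mul1g.
  by rewrite {1}E conjMg cyc // swap // Et conjMg cyc // swap.
apply/centP=> v Vv; apply/commute_sym/commgP/conjg_fixP.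
have -> : [~ g, t] = (t * g)^-1 * (g * t) by group_id.
by rewrite conjgM comm ?conjgKV // memJ_norm // groupV groupM.
Qed.

(** Some b in Q makes z = [tb, c] nontrivial, because c is not central.  The
    commutator [tb, ca] is then d z with d = [tb, a]; here d commutes with z and
    is congruent to [t, a] modulo Q, so it is not a q-element. *)
Lemma central_commutator_absurd (gT : finGroupType) (G Q : {group gT}) q a t c :
    CPPO G -> Q \subset G -> q.-group Q -> Q^`(1) \subset 'Z(Q) ->
    a \in G -> t \in G -> a \in 'N(Q) -> t \in 'N(Q) ->
    a \in 'C('Z(Q)) -> [~ t, a] \in 'C('Z(Q)) ->
    q^'.-elt [~ t, a] -> [~ t, a] != 1 ->
    c \in Q -> c \notin 'Z(Q) -> [~ t, c] \in 'Z(Q) ->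
  False.
Proof.
move=> cG sQG qQ sQ'Z Ga Gt nQa nQt cZa cZta q'ta ta1 Qc nZc Ztc.
have [b Qb tbc1] : exists2 b, b \in Q & [~ t * b, c] != 1.
  have [tc1 | tc1] := eqVneq [~ t, c] 1; last by exists 1;
    rewrite ?group1 // mulg1.
  have : ~~ (Q \subset 'C[c]) by rewrite sub_cent1; apply: contra nZc => cQc;
    rewrite inE Qc.
  case/subsetPn=> b Qb ncb; exists b => //.
  rewrite commMgJ tc1 conj1g mul1g; apply: contra ncb => /commgP cbc.
  exact/cent1P.
set z := [~ t * b, c] in tbc1.
have Zz : z \in 'Z(Q).
  rewrite /z commMgJ groupM //.
    by rewrite memJ_norm // (subsetP (normal_norm (center_normal Q))).
  by rewrite (subsetP sQ'Z) // mem_commg.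
set d := [~ t * b, a].
have Qba : [~ b, a] \in Q by rewrite commgEl groupM ?groupV // memJ_norm.
have cZQ : Q \subset 'C('Z(Q)) by rewrite centsC subsetIr.
have cZd : d \in 'C('Z(Q)).
  by rewrite /d commMgJ groupM ?groupJ // (subsetP cZQ).
have dz : commute d z := centP cZd z Zz.
have Qz := subsetP (center_sub Q) z Zz.
(* d and [t, a] have the same image modulo Q. *)
have nq : ~~ q.-elt d.
  apply: contra ta1 => qd; have nQb := subsetP (normG Q) b Qb.
  have nQta : [~ t, a] \in 'N(Q) by rewrite groupR.
  have Ed : coset Q d = coset Q [~ t, a].
    rewrite /d commMgJ morphM ?(subsetP (normG Q) _ Qba) ?groupJ //=.
    by rewrite (coset_id Qba) mulg1 morphJ //= (coset_id Qb) conjg1.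
  have nQd : d \in 'N(Q) by rewrite groupR // groupM.
  have E1 : coset Q [~ t, a] = 1.
    have q1 : q.-elt (coset Q [~ t, a]) by rewrite -Ed morph_p_elt.
    have q2 : q^'.-elt (coset Q [~ t, a]) by rewrite morph_p_elt.
    by apply/eqP; rewrite -order_eq1 (pnat_1 q1 q2).
  have Qta := coset_idr nQta E1.
  by rewrite -order_eq1 (pnat_1 (mem_p_elt qQ Qta) q'ta).
have Gtb : t * b \in G by rewrite groupM // (subsetP sQG).
have [p [k [p_pr od]]] := cG _ _ Gtb Ga.
have q'd : q^'.-elt d.
  have pd : p.-nat (p ^ k)%N by rewrite pnatX pnat_id.
  rewrite /p_elt od; apply: (pi_pnat pd); apply: contra nq => qp.
  by rewrite /p_elt od; apply: pi_pnat pd qp.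
have Gca : c * a \in G by rewrite groupM // (subsetP sQG).
have [p2 [k2 [p2_pr]]] := cG _ _ Gtb Gca.
have -> : [~ t * b, c * a] = z * d.
  rewrite commgMJ -/d -/z -dz; congr (_ * _); apply/conjg_fixP/commgP.
  by apply/commute_sym/(centP cZa).
apply: (@prime_power_not_mixed _ q) => //.
- exact: mem_p_elt Qz.
- by apply: contraNneq nq => ->; rewrite /p_elt order1.
Qed.

(** If h = [u, sigma] is nontrivial and centralises K0, then so does sigma, and
    hence so do all commutators [w, sigma] with w in Q.  These cover Q modulo
    its Frattini subgroup Z(Q), so Q centralises K0. *)
Lemma tight_comm_faithful (gT : finGroupType) (G K Q S K0 : {group gT}) t r q s
    a u :
    tight_tower G K Q S t r q s -> a \in S -> [~ a, t] \notin 'C(Q) ->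
    K0 \subset K -> Q \subset 'N(K0) -> ~~ ('Z(Q) \subset 'C(K0)) ->
    u \in Q -> [~ u, [~ a, t]] \in 'C(K0) ->
  u \in 'Z(Q).
Proof.
move=> T Sa; set sg := [~ a, t] => nC sK0 nK0Q ncZ Qu cK0.
have [[ZQ ZQ'] _] := tight_special T Sa nC.
have nQs : sg \in 'N(Q) := subsetP (tower_NQS T) sg (tight_comm_mem T Sa).
apply: (tight_central_of_comm T Sa nC Qu); rewrite -/sg.
have [-> | h1] := eqVneq [~ u, sg] 1; first exact: group1.
case/negP: ncZ; have cs : sg \in 'C(K0).
  rewrite -sub_cent1; apply: (@subset_trans _ _ 'C_K[[~ u, sg]]).
    by rewrite subsetI sK0 sub_cent1.
  apply: subset_trans (tight_comm_cent T Sa Qu h1) _.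
  by rewrite -cent_cycle centS // joing_subr.
suff sQC : Q \subset 'C_Q(K0).
  by rewrite (subset_trans (center_sub Q)) // (subset_trans sQC) ?subsetIr.
have E : <<'C_Q(K0)>> = Q; last by rewrite -{1}E genGid.
apply: Phi_nongen; apply/eqP; rewrite eqEsubset join_subG Phi_sub subsetIl /=.
apply/subsetP=> v Qv; have [w Qw [z Zz ->]] := tight_comm_surj T Sa nC Qv.
rewrite -/sg groupM //; last by rewrite mem_gen // inE ZQ Zz.
rewrite mem_gen // !inE; apply/orP; right.
have Qws : [~ w, sg] \in Q by rewrite commgEl groupM ?groupV // memJ_norm.
rewrite Qws commgEr groupM // memJ_norm ?groupV //.
exact: subsetP (norms_cent nK0Q) w Qw.
Qed.

(** It suffices to treat h = [u, sigma].  Since h^2 is trivial on K0, each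
    product k k^h is fixed by h, hence by sigma.  So h and its conjugate under
    sigma both invert K0 modulo C_K0(h), and [h, sigma] centralises both C_K0(h)
    and K0 / C_K0(h).  By coprimality [h, sigma] centralises K0, and
    [tight_comm_faithful] applies to it. *)
Lemma tight_square_central (gT : finGroupType) (G K Q S K0 : {group gT}) t r s a
    g :
    tight_tower G K Q S t r 2 s -> a \in S -> [~ a, t] \notin 'C(Q) ->
    K0 \subset K -> Q \subset 'N(K0) -> S \subset 'N(K0) ->
    ~~ ('Z(Q) \subset 'C(K0)) ->
    g \in Q -> g ^+ 2 \in 'C(K0) ->
  g \in 'Z(Q).
Proof.
move=> T Sa; set sg := [~ a, t] => nC sK0 nK0Q nK0S ncZ Qg cg2.
have [spQ _] := tight_special T Sa nC.
have abelZ := center_special_abelem (tower_qQ T) spQ.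
have [abZ expZ] := abelemP (isT : prime 2) abelZ.
have Ssg : sg \in S := tight_comm_mem T Sa.
have nQs : sg \in 'N(Q) := subsetP (tower_NQS T) sg Ssg.
have nK0s : sg \in 'N(K0) := subsetP nK0S sg Ssg.
have [u Qu [z Zz Eg]] := tight_comm_surj T Sa nC Qg; rewrite -/sg in Eg.
set h := [~ u, sg] in Eg.
have Qh : h \in Q by rewrite /h commgEl groupM ?groupV // memJ_norm.
have {cg2} ch2 : h ^+ 2 \in 'C(K0).
  have /setIP[_ cz] := Zz.
  move: cg2; rewrite Eg expgMn; last by apply/commute_sym/(centP cz).
  by rewrite (expZ z) // mulg1.
rewrite Eg groupM // {g Qg Eg}.
have [-> | h1] := eqVneq h 1; first exact: group1.
apply: (tight_comm_faithful T Sa nC sK0 nK0Q ncZ Qh); rewrite -/sg.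
set g := [~ h, sg].
have abK0 := abelianS sK0 (tower_abK T).
have cC k : k \in K0 -> commute k h -> commute k sg.
  move=> K0k ckh; have : k \in 'C_K[h] by rewrite inE (subsetP sK0) //;
    apply/cent1P.
  move/(subsetP (tight_comm_cent T Sa Qu h1))/centP; apply.
  by rewrite mem_gen // inE cycle_id orbT.
have nK0h : h \in 'N(K0) := subsetP nK0Q h Qh.
have fixh k : k \in K0 -> commute (k * k ^ h) h.
  move=> K0k; have K0kh : k ^ h \in K0 by rewrite memJ_norm.
  apply/commgP/conjg_fixP; rewrite conjMg -conjgM -expg2.
  have -> : k ^ (h ^+ 2) = k.
    by apply/conjg_fixP/commgP/commute_sym; apply: (centP ch2).
  exact: (centsP abK0).
have Qg : g \in Q by rewrite /g commgEl groupM ?groupV // memJ_norm.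
pose C0 := 'C_K0[h]%G.
have comm_C0 m : m \in K0 -> [~ m, g] \in C0.
  move=> K0m; pose k := m ^ h^-1; pose k' := k ^ sg^-1.
  have K0k : k \in K0 by rewrite memJ_norm ?groupV.
  have K0k' : k' \in K0 by rewrite memJ_norm ?groupV.
  have C0fix l : l \in K0 -> l * l ^ h \in C0.
    move=> K0l; rewrite inE groupM // ?memJ_norm //=; apply/cent1P; exact: fixh.
  have Em : m = k ^ h by rewrite conjgKV.
  have Emg : m ^ g = k ^ (h ^ sg) by rewrite /g commgEl conjgM -/k.
  (* k' k'^h is fixed by sigma, and sigma maps it to k k^(h^sigma) = k m^g. *)
  have E2 : k' * k' ^ h = k * m ^ g.
    have cks : commute (k' * k' ^ h) sg.
      by apply: cC; [rewrite groupM // memJ_norm | apply: fixh].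
    have /conjg_fixP <- : [~ k' * k' ^ h, sg] == 1 by apply/commgP.
    rewrite conjMg conjgKV Emg; congr (_ * _).
    by rewrite /k' -!conjgM.
  have -> : [~ m, g] = (k * k ^ h)^-1 * (k' * k' ^ h).
    by rewrite E2 -Em commgEl invMg -mulgA mulKg.
  by rewrite groupM ?groupV ?C0fix.
have cg : g \in 'C(C0).
  apply/centP=> c /setIP[K0c /cent1P cch].
  have cs : commute c sg by apply: cC.
  by apply/cent1P; rewrite groupR //; apply/cent1P/commute_sym.
have nC0g : g \in 'N(C0) by apply: (subsetP (cent_sub _)).
have nK0g : <[g]> \subset 'N(K0) by rewrite cycle_subG (subsetP nK0Q).
have sR : [~: K0, <[g]>] \subset C0 by apply: comm_cycle_sub.
have coK0g : coprime #|K0| #|<[g]>|.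
  by apply: pnat_coprime (pgroupS sK0 (tower_rK T)) (mem_p_elt (tight_r'Q T)
    Qg).
suff /commG1P : [~: K0, <[g]>] = 1 by rewrite cent_cycle sub_cent1.
rewrite -(coprime_commg_id (abelian_sol abK0) nK0g coK0g); apply/commG1P.
by rewrite (subset_trans sR) // cent_cycle sub_cent1.
Qed.

(** Only q = 2 is left.  Choose B of index 2 in Z(Q) such that C_K(B) is not
    centralised by Z(Q).  Squares of noncentral elements of Q are not in B, and
    as (vw)^2 = v^2 w^2 [w, v], neither is [v, w] when v, w and vw are
    noncentral.  Bilinearity of the commutator modulo B then leaves room for
    at most three nontrivial cosets of Z(Q), and [four_group_cent] applies
    unless t fixes one of them. *)
Lemma tight_cent (gT : finGroupType) (G K Q S : {group gT}) t r q s a :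
    tight_tower G K Q S t r q s -> a \in S -> [~ a, t] \in 'C(Q).
Proof.
move=> T Sa; apply/negPn/negP=> nC.
move: (T); rewrite (tight_even T Sa nC) => {q}T.
have [spQ _] := tight_special T Sa nC; have [ZQ ZQ'] := spQ.
have qQ := tower_qQ T; have sZQ := center_sub Q.
have abelZ := center_special_abelem qQ spQ; have abZ := abelem_abelian abelZ.
have nZQ : Q \subset 'N('Z(Q)) := normal_norm (center_normal Q).
have ncK : ~~ (K \subset 'C('Z(Q))).
  apply: contra (tight_nonabelian T Sa nC) => cKZ; apply/derG1P/trivgP.
  by rewrite /= ZQ' -(tower_faith T) subsetI sZQ centsC.
have nKQ := tower_NKQ T; have nKS := tower_NKS T.
have coKZ : coprime #|K| #|'Z(Q)|.
  by apply: pnat_coprime (tower_rK T) (pgroupS sZQ (tight_r'Q T)).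
have [B [sBZ cycZB nsC]] := abelian_action_cyclic_quotient abZ (tower_abK T)
  (subset_trans sZQ nKQ) coKZ ncK.
pose K0 := 'C_K(B)%G.
have sK0 : K0 \subset K := subsetIl _ _.
have cBQ : Q \subset 'C(B) by rewrite centsC (subset_trans sBZ) // subsetIr.
have cBS : S \subset 'C(B)
  by rewrite (subset_trans (tight_cent_center T Sa nC)) // centS.
have nK0Q : Q \subset 'N(K0) by rewrite normsI // norms_cent // cents_norm.
have nK0S : S \subset 'N(K0) by rewrite normsI // norms_cent // cents_norm.
have ncZ : ~~ ('Z(Q) \subset 'C(K0)) by rewrite centsC.
have sq g : g \in Q -> g ^+ 2 \in B -> g \in 'Z(Q).
  move=> Qg Bg; apply: (tight_square_central T Sa nC sK0 nK0Q nK0S ncZ Qg).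
  by apply: subsetP Bg; rewrite centsC subsetIr.
(* Z(Q) / B has order 2. *)
have mulB x y : x \in 'Z(Q) -> y \in 'Z(Q) -> x \notin B -> y \notin B ->
  x * y \in B.
  have nBZ : 'Z(Q) \subset 'N(B) := sub_abelian_norm abZ sBZ.
  move=> Zx Zy nBx nBy; have [nx ny] := (subsetP nBZ x Zx, subsetP nBZ y Zy).
  have ne z : z \in 'Z(Q) -> z \notin B -> coset B z != 1.
    by move=> Zz; apply: contra => /eqP/(coset_idr (subsetP nBZ z Zz)).
  have abelZB : 2.-abelem ('Z(Q) / B) := quotient_abelem B abelZ.
  have Vx : coset B x \in 'Z(Q) / B by rewrite mem_quotient.
  have Vy : coset B y \in 'Z(Q) / B by rewrite mem_quotient.
  have ox : #[coset B x] = 2 by apply: abelem_order_p abelZB Vx (ne x Zx nBx).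
  have oV : #|'Z(Q) / B| = 2.
    by apply: cyclic_abelem_prime abelZB cycZB _; apply/trivgPn;
      exists (coset B x); rewrite ?ne.
  have defV : <[coset B x]> = 'Z(Q) / B.
    by apply/eqP; rewrite eqEcard cycle_subG Vx oV [#|<[_]>|]ox.
  apply: coset_idr; first by rewrite groupM.
  rewrite morphM //=; move: (ne y Zy nBy);
    have : coset B y \in <[coset B x]> by rewrite defV.
  case/cycleP=> i ->; rewrite -expg_mod_order ox modn2; case: (odd i);
    rewrite ?eqxx // => _.
  by rewrite -expgS -ox expg_order.
(* Otherwise (vw)^2 would lie in B. *)
have commB v w : v \in Q -> w \in Q -> v \notin 'Z(Q) -> w \notin 'Z(Q) ->
    v * w \notin 'Z(Q) -> [~ v, w] \notin B.
  move=> Qv Qw nv nw; apply: contra => Bvw; apply: (sq _ (groupM Qv Qw)).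
  have Bwv : [~ w, v] \in B by rewrite -invg_comm groupV.
  have Zwv : [~ w, v] \in 'Z(Q) := subsetP sBZ _ Bwv.
  have cwv g : g \in Q -> commute g [~ w, v].
    by move=> Qg; have /setIP[_ /centP/(_ g Qg)/commute_sym] := Zwv.
  rewrite expMg_Rmul ?binn ?expg1; [|exact: cwv..].
  rewrite groupM // mulB ?(tight_exp_center T Sa nC) //.
    by apply: contra nv; apply: sq.
  by apply: contra nw; apply: sq.
have four v w x : v \in Q -> w \in Q -> x \in Q ->
    v \notin 'Z(Q) -> w \notin 'Z(Q) -> x \notin 'Z(Q) ->
    v * w \notin 'Z(Q) -> v * x \notin 'Z(Q) -> w * x \notin 'Z(Q) ->
  v * w * x \in 'Z(Q).
  move=> Qv Qw Qx nv nw nx nvw nvx nwx; apply/negPn/negP=> nvwx.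
  have /negP[] : [~ v, w * x] \notin B by apply: (commB) => //;
    [exact: groupM | rewrite mulgA].
  have ZQQ y z : y \in Q -> z \in Q -> [~ y, z] \in 'Z(Q).
    by move=> Qy Qz; rewrite -ZQ' mem_commg.
  have -> : [~ v, w * x] = [~ v, x] * [~ v, w].
    rewrite commgMJ; congr (_ * _); apply/conjg_fixP/commgP.
    by have /setIP[_ /centP/(_ x Qx)] := ZQQ v w Qv Qw.
  by apply: mulB; rewrite ?ZQQ ?commB.
have sNZ := tight_norm_center T.
have nZt : t \in 'N('Z(Q)) by apply: (subsetP sNZ);
  rewrite mem_gen // inE cycle_id orbT.
have nZS : S \subset 'N('Z(Q)) by apply: subset_trans sNZ; rewrite joing_subl.
have cosetZ v : v \in Q -> (coset 'Z(Q) v == 1) = (v \in 'Z(Q)).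
  move=> Qv; apply/eqP/idP=> [|Zv]; last exact: coset_id.
  exact: coset_idr (subsetP nZQ v Qv).
case: (tight_noncommuting T Sa nC) => b Sb nCb.
have Ssg := tight_comm_mem T Sb.
apply: four_group_cent.
- by rewrite -ZQ Phi_quotient_abelem.
- by apply: (subsetP (quotient_norms _ (tower_NQS T))); rewrite mem_quotient.
- by rewrite -cycle_subG -quotient_cycle // quotient_norms //
    cycle_subG (tower_NQt T).
- move=> _ _ _ /morphimP[v nv Qv ->] /morphimP[w nw Qw ->] /morphimP[x nx Qx ->]
    /=.
  have [Qvw Qvx Qwx] : [/\ v * w \in Q, v * x \in Q & w * x \in Q]
    by rewrite !groupM.
  rewrite -!morphM //=; last exact: groupM.
  rewrite (cosetZ v Qv) (cosetZ w Qw) (cosetZ x Qx) (cosetZ _ Qvw) (cosetZ _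
    Qvx) (cosetZ _ Qwx).
  by move=> *; apply: coset_id; apply: four.
- move=> v Vv /conjg_fixP/commgP cv; apply/set1P.
  by rewrite -[[set 1]](tight_quotient_fix T Sb nCb) inE Vv; apply/cent1P.
move=> _ /morphimP[c nc Qc ->] /conjg_fixP; rewrite -morphR //= => ct1.
apply/eqP; rewrite cosetZ //; apply/negPn/negP=> nZc.
have Gb := subsetP (tower_SG T) b Sb.
have cZS := tight_cent_center T Sa nC.
have bt1 : [~ b, t] != 1 by apply: contraNneq nCb => ->; apply: group1.
apply: (@central_commutator_absurd _ G Q 2 b t c);
  rewrite -?[[~ t, b]]invg_comm ?groupV //.
- exact: tower_CPPO T.
- exact: tower_QG T.
- by rewrite ZQ'.
- exact: tower_tG T.
- exact: subsetP (tower_NQS T) b Sb.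
- exact: tower_NQt T.
- exact: subsetP cZS b Sb.
- exact: subsetP cZS _ Ssg.
- by rewrite p_eltV (mem_p_elt (tight_q'S T)).
- by rewrite invg_eq1.
rewrite -invg_comm groupV -cosetZ //.
by rewrite commgEl groupM ?groupV // memJ_norm // (tower_NQt T).
Qed.

(** * Towers do not exist *)

(** By induction on the order of Q plus the order of S, one may assume that
    Q = [Q, S], that S = [S, t], and that the claim holds for the t-invariant
    proper subgroups of S: the tower is then tight. *)
Lemma tower_cent (gT : finGroupType) (G K Q S : {group gT}) t r q s :
  tower G K Q S t r q s -> [~: S, <[t]>] \subset 'C(Q).
Proof.
move: {2}_.+1 (ltnSn (#|Q| + #|S|)) => n.
elim: n Q S => // n IHn Q S; rewrite ltnS => leQSn T.
have [cG sKG sQG sSG Gt abK rK qQ sS q_pr rq sq s't nSt nQS nQt nKQ nKS nKt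
  faith] := T.
have ntS : <[t]> \subset 'N(S) by rewrite cycle_subG.
have ntQ : <[t]> \subset 'N(Q) by rewrite cycle_subG.
have coSt : coprime #|S| #|<[t]>| by apply: pnat_coprime sS s't.
have q'S : q^'.-group S by apply: p_group_p'group sS.
have coQS : coprime #|Q| #|S| := pnat_coprime qQ q'S.
have lift (Q1 S1 : {group gT}) : Q1 \subset Q -> S1 \subset S -> t \in 'N(S1) ->
    S1 \subset 'N(Q1) -> t \in 'N(Q1) -> (Q1 != Q) || (S1 != S) ->
    [~: S1, <[t]>] \subset 'C(Q1).
  move=> sQ1 sS1 nS1t nQ1S nQ1t ne; apply: IHn.
    apply: leq_trans leQSn; move: ne; rewrite -!(inj_eq val_inj) /=.
    case/orP=> ne.
      by rewrite -addSn leq_add ?subset_leq_card // proper_card //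
        properEneq ne.
    by rewrite -addnS leq_add ?subset_leq_card // proper_card // properEneq ne.
  split=> //.
  - exact: subset_trans sQG.
  - exact: subset_trans sSG.
  - exact: pgroupS qQ.
  - exact: pgroupS sS.
  - exact: subset_trans nKQ.
  - exact: subset_trans nKS.
  - by apply/trivgP; rewrite -faith setSI.
pose S1 := [~: S, <[t]>]%G; pose Q1 := [~: Q, S]%G.
have sS1 : S1 \subset S by rewrite commg_subl.
have sQ1 : Q1 \subset Q by rewrite commg_subl.
have nQ1S : S \subset 'N(Q1) by rewrite commg_normr.
have nQ1t : t \in 'N(Q1) by rewrite -cycle_subG normsR.
have nS1t : t \in 'N(S1) by rewrite -cycle_subG commg_normr.
have nQS1 := subset_trans sS1 nQS.
have [defQ | ne] := eqVneq Q1 Q; last first.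
  have cQ1 : [~: S, <[t]>] \subset 'C(Q1) by apply: lift; rewrite ?ne.
  have coQS1 : coprime #|Q| #|S1| := coprimegS sS1 coQS.
  rewrite centsC; apply/commG1P;
    rewrite -(coprime_commg_id (pgroup_sol qQ) nQS1 coQS1).
  by apply/commG1P; rewrite centsC (subset_trans cQ1) // centS // commgS.
have [defS | ne] := eqVneq S1 S; last first.
  by rewrite -(coprime_commg_id (pgroup_sol sS) ntS coSt); apply: lift;
    rewrite ?ne ?orbT.
(* The t-conjugates of a generate a t-invariant group on which t acts
   nontrivially, which by induction is not smaller than S. *)
have gen a : a \in S -> [~ a, t] \notin 'C(Q) -> S \subset <[a]> <*> <[t]>.
  move=> Sa nCa; pose S2 := << a ^: <[t]> >>%G.
  have sS2 : S2 \subset S by rewrite gen_subG class_sub_norm.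
  have S2a : a \in S2 by rewrite mem_gen // class_refl.
  have nS2t : t \in 'N(S2) by rewrite -cycle_subG norms_gen // class_norm.
  have [<- | ne] := eqVneq S2 S.
    rewrite gen_subG; apply/subsetP=> _ /imsetP[x tx ->].
    by rewrite groupJ // mem_gen // inE ?cycle_id ?tx ?orbT.
  case/negP: nCa; have sC : [~: S2, <[t]>] \subset 'C(Q).
    by apply: lift; rewrite ?ne ?orbT // (subset_trans sS2).
  by rewrite (subsetP sC) // mem_commg ?cycle_id.
have C : tight_tower G K Q S t r q s by split=> //;
  [move/(congr1 (@gval _)): defQ | move/(congr1 (@gval _)): defS].
apply: comm_cycle_sub => [|a Sa]; last exact: tight_cent C Sa.
by rewrite -cycle_subG norms_cent.
Qed.

(** * Normal subgroups of coprime orders *)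

(** A group is not the union of two proper subgroups, so if neither A nor B is
    central some g centralises neither.  With [a, g] and [b, g] nontrivial, the
    commutator [ab, g] = [a, g] [b, g] has mixed order. *)
Lemma normal_coprime_central (gT : finGroupType) (G A B : {group gT}) :
    CPPO G -> A <| G -> B <| G -> coprime #|A| #|B| ->
  (G \subset 'C(A)) || (G \subset 'C(B)).
Proof.
move=> cG nAG nBG co; apply/negPn/negP; rewrite negb_or => /andP[nA nB].
have [g Gg [ngA ngB]] : exists2 g, g \in G & g \notin 'C(A) /\ g \notin 'C(B).
  case/subsetPn: nA => x Gx nxA; case/subsetPn: nB => y Gy nyB.
  have [xB | nxB] := boolP (x \in 'C(B)); last by exists x.
  have [yA | nyA] := boolP (y \in 'C(A)); last by exists y.
  by exists (x * y); [rewrite groupM | rewrite groupMr // groupMl].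
have ex (H : {group gT}) : g \notin 'C(H) -> exists2 h, h \in H & [~ h, g] != 1.
  move=> nH; have : ~~ (H \subset 'C[g]) by rewrite sub_cent1.
  by case/subsetPn=> h Hh /cent1P nc; exists h => //; apply/commgP.
have [a Aa a1] := ex A ngA; have [b Bb b1] := ex B ngB.
have Gx (H : {group gT}) h : H <| G -> h \in H -> [~ h, g] \in H.
  move=> /andP[_ nHG] Hh; rewrite commgEl groupM ?groupV // memJ_norm //.
  exact: subsetP Gg.
have Aag := Gx A a nAG Aa; have Bbg := Gx B b nBG Bb.
have cAB : A \subset 'C(B).
  apply/commG1P/trivgP; rewrite -(coprime_TIg co) commg_subI //.
    by rewrite subsetI subxx (subset_trans (normal_sub nAG) (normal_norm nBG)).
  by rewrite subsetI subxx (subset_trans (normal_sub nBG) (normal_norm nAG)).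
have Gab : a * b \in G.
  exact: groupM (subsetP (normal_sub nAG) a Aa) (subsetP (normal_sub nBG) b Bb).
have [p [k [p_pr]]] := cG _ _ Gab Gg.
have -> : [~ a * b, g] = [~ a, g] * [~ b, g].
  rewrite commMgJ; congr (_ * _); apply/conjg_fixP/commgP.
  exact: (centsP cAB).
apply: (@prime_power_not_mixed _ \pi(A)) => //.
- exact: (centsP cAB).
- exact: mem_p_elt (pgroup_pi A) Aag.
by apply: mem_p_elt Bbg; rewrite /pgroup -coprime_pi' // cardG_gt0.
Qed.

(** Of O_p(N) and O_p'(N) one is central in G, and it contributes nothing to
    N = [N, G]. *)
Lemma nilpotent_comm_pgroup (gT : finGroupType) (G N : {group gT}) :
    CPPO G -> N <| G -> nilpotent N -> [~: N, G] = N -> N :!=: 1 ->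
  exists2 p, prime p & p.-group N.
Proof.
move=> cG nNG nilN defN ntN; set p := pdiv #|N|.
have p_pr : prime p by rewrite pdiv_prime // cardG_gt1.
exists p => //; set A := 'O_p(N)%G; set B := 'O_p^'(N)%G.
have nAG : A <| G := gFnormal_trans _ nNG.
have nBG : B <| G := gFnormal_trans _ nNG.
have defAB := nilpotent_pcoreC p nilN.
have co : coprime #|A| #|B|
  by apply: pnat_coprime (pcore_pgroup _ _) (pcore_pgroup _ _).
have [_ mulAB _ _] := dprodP defAB.
have sub (X Y : {group gT}) : Y <| G -> G \subset 'C(X) -> X * Y = N ->
  N \subset Y.
  move=> nYG cXG defXY; rewrite -{1}defN -defXY.
  have cX1 : [~: X, G] = 1 by apply/commG1P; rewrite centsC.
  by rewrite commMG cX1 ?norm1 ?subsetT // mul1g commg_subl normal_norm.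
case/orP: (normal_coprime_central cG nAG nBG co) => cH.
  have sNB := sub A B nBG cH mulAB.
  have p'N : p^'.-group N := pgroupS sNB (pcore_pgroup _ _).
  by move: p'N; rewrite /pgroup p'natE ?pdiv_dvd.
have sNA : N \subset A.
  by apply: (sub B A) => //; rewrite -mulAB; apply/esym/normC;
    rewrite (subset_trans (pcore_sub _ _)) // gFnorm.
exact: pgroupS sNA (pcore_pgroup _ _).
Qed.

(** * Nilpotent residuals and the Fitting height *)

(** The lower central series loses at least one element at each strict step.
    Any term with a large enough index is therefore the nilpotent residual;
    fixing one index for all the groups considered makes it compatible with
    quotients. *)
Lemma lcn_stable (gT : finGroupType) (G : {group gT}) n :
  #|G| <= n -> [~: 'L_n.+1(G), G] = 'L_n.+1(G).
Proof.
move=> leGn;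
  suff : ([~: 'L_n.+1(G), G] == 'L_n.+1(G)) || (#|'L_n.+1(G)| + n <= #|G|).
  case/orP=> [/eqP // | le]; have := leq_trans le leGn.
  by rewrite -[X in _ <= X]add0n leq_add2r leqNgt cardG_gt0.
elim: n {leGn} => [|n]; first by rewrite lcn1 addn0 leqnn orbT.
have [eqL _ | neL] := eqVneq 'L_n.+2(G) 'L_n.+1(G).
  by rewrite eqL -lcnSn eqL eqxx.
move=> /= leL.
apply/orP; right; apply: leq_trans leL; rewrite addnS -addSn leq_add2r.
by rewrite proper_card // properEneq neL lcn_subS.
Qed.

Lemma lcn_nilpotent_quotient (gT : finGroupType) (G : {group gT}) n :
  nilpotent (G / 'L_n.+1(G)).
Proof.
apply/lcnP; exists n; rewrite -[RHS](trivg_quotient 'L_n.+1(G)).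
by rewrite /quotient morphim_lcn // lcn_norm.
Qed.

Lemma lcn_nilpotent_eq1 (gT : finGroupType) (G : {group gT}) n :
  #|G| <= n -> nilpotent G -> 'L_n.+1(G) = 1.
Proof.
move=> leGn nilG; apply/eqP/negPn/negP=> nt.
have := @nil_comm_properl _ G 'L_n.+1(G)%G G nilG (lcn_sub _ _) nt.
by rewrite subsetI subxx lcn_norm (lcn_stable leGn) properxx => /(_ isT).
Qed.

Lemma mul_Sylow_quotient (gT : finGroupType) (p : nat) (K H P : {group gT}) :
  K <| H -> p.-Sylow(H) P -> p.-group (H / K) -> K * P = H.
Proof.
move=> nKH sylP pHK; have sPH := pHall_sub sylP;
  have nKP := subset_trans sPH (normal_norm nKH).
have sylPK : p.-Sylow(H / K) (P / K) by rewrite quotient_pHall.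
have [sKH nKH'] := andP nKH.
apply/eqP; rewrite eqEsubset mul_subG //= -quotientSK //.
by rewrite -{1}(pHall_id sylPK pHK).
Qed.

(** J is the product of a Sylow p-subgroup P and of C_J(S), because every
    p'-element lies in the latter.  So S = [S, J] = [S, P], impossible in the
    nilpotent group P unless S = 1. *)
Lemma comm_p'elt_cent_trivial (gT : finGroupType) (S J : {group gT}) (p : nat) :
    S <| J -> p.-group S -> [~: S, J] = S ->
    (forall x, x \in J -> p^'.-elt x -> x \in 'C(S)) ->
  S :=: 1.
Proof.
move=> nSJ pS defS cent; have [sSJ nSJ'] := andP nSJ.
set E := 'C_J(S)%G.
have nEJ : E <| J by rewrite /normal subsetIl normsI ?normG ?norms_cent.
have pJE : p.-group (J / E).
  apply/pgroupP=> k k_pr /(Cauchy k_pr)[_ /morphimP[x nx Jx ->] ok].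
  have Ex : coset E x = coset E x.`_p.
    have Ex' : x.`_p^' \in E
      by rewrite inE groupX // cent // ?groupX // p_elt_constt.
    by rewrite -{1}(consttC p x) morphM ?groupX //= (coset_id Ex') mulg1.
  have : p.-elt (coset E x) by rewrite Ex morph_p_elt ?p_elt_constt // groupX.
  by rewrite /p_elt ok pnatE.
have [P sylP] := Sylow_exists p J.
have defJ := mul_Sylow_quotient nEJ sylP pJE.
have sSP : S \subset P.
  have [g Jg sSPg] := Sylow_subJ sylP sSJ pS.
  by rewrite -(normsP nSJ' g^-1 _) ?groupV // sub_conjgV.
apply/eqP/negPn/negP=> ntS.
have : [~: S, P] \proper S.
  apply: (nil_comm_properl (pgroup_nil (pHall_pgroup sylP))) => //.
  by rewrite subsetI subxx (subset_trans (pHall_sub sylP)).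
suff -> : [~: S, P] = S by rewrite properxx.
rewrite -[RHS]defS -defJ [LHS]commGC [RHS]commGC commMG.
  by rewrite [X in X * _](commG1P _) ?mul1g // subsetIr.
by rewrite [X in 'N(X)](commG1P _) ?norm1 ?subsetT // subsetIr.
Qed.

Lemma lcn_quotient (gT : finGroupType) (G N : {group gT}) n :
  G \subset 'N(N) -> 'L_n(G / N) = 'L_n(G) / N.
Proof. by move=> nNG; rewrite /quotient morphim_lcn. Qed.

Lemma residual_pgroup_factor (gT : finGroupType) (G H R : {group gT}) :
    CPPO G -> H <| G -> R <| G -> R \subset H -> R != H -> nilpotent (H / R) ->
    [~: H, G] = H ->
  exists2 p, prime p & p.-group (H / R).
Proof.
move=> cG nHG nRG sRH neRH nilHR defH; have [sHG nHG'] := andP nHG.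
have nRG' := normal_norm nRG; have nRH := subset_trans sHG nRG'.
apply: (@nilpotent_comm_pgroup _ (G / R)%G) => //.
- exact: CPPO_quotient.
- exact: quotient_normal.
- by rewrite -quotientR // defH.
apply: contra neRH => /eqP HR1; rewrite -(inj_eq val_inj) /= eqEsubset sRH.
by rewrite -quotient_sub1 //; apply/trivgP.
Qed.

(** In a counterexample of least order, the third residual K is the only minimal
    normal subgroup.  Frattini arguments for a Sylow q-subgroup Q of the second
    residual R2 = K Q, and for a Sylow s-subgroup S of the intersection of the
    first residual with M = N_G(Q), provide a tower; its top t ranges over the
    s'-elements of J = N_M(S).  By [tower_cent] all of these act trivially on S
    modulo C_S(Q); as S = [S, J], this leaves S = C_S(Q), against Q = [Q, S]. *)
Lemma CPPO_residual_trivial n (gT : finGroupType) (G : {group gT}) :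
    #|G| <= n -> solvable G -> CPPO G ->
  'L_n.+1('L_n.+1('L_n.+1(G))) = 1.
Proof.
move: {2}_.+1 (ltnSn #|G|) => m; elim: m gT G => // m IHm gT G.
rewrite ltnS => leGm leGn solG cG.
set R1 := 'L_n.+1(G)%G; set R2 := 'L_n.+1(R1)%G; set K := 'L_n.+1(R2)%G.
apply/eqP/negPn/negP; rewrite -/(gval K) => ntK.
have sR1G : R1 \subset G := lcn_sub _ _.
have sR21 : R2 \subset R1 := lcn_sub _ _.
have sKR2 : K \subset R2 := lcn_sub _ _.
have sR2G := subset_trans sR21 sR1G.
have leR1 : #|R1| <= n by apply: leq_trans leGn; apply: subset_leq_card.
have leR2 : #|R2| <= n by apply: leq_trans leGn; apply: subset_leq_card.
have chR1 : R1 \char G := lcn_char _ _.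
have chR2 : R2 \char G := char_trans (lcn_char _ _) chR1.
have chK : K \char G := char_trans (lcn_char _ _) chR2.
have [nR1G nR2G nKG] : [/\ R1 <| G, R2 <| G & K <| G] by rewrite !char_normal.
have defR1 : [~: R1, G] = R1 := lcn_stable leGn.
have defR2 : [~: R2, R1] = R2 := lcn_stable leR1.
have defK : [~: K, R2] = K := lcn_stable leR2.
have defR2G : [~: R2, G] = R2.
  apply/eqP; rewrite eqEsubset commg_subl normal_norm //=.
  by rewrite -{1}defR2 commgS.
have defKG : [~: K, G] = K.
  apply/eqP; rewrite eqEsubset commg_subl normal_norm //=.
  by rewrite -{1}defK commgS.
(* By minimality of G, its third residual becomes trivial in G / N. *)
have minK (N : {group gT}) : N <| G -> N :!=: 1 -> K \subset N.
  move=> nNG ntN; have nNG' := normal_norm nNG.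
  have ltm : #|G / N| < m.
    apply: leq_trans leGm; rewrite ltn_quotient //; exact: normal_sub.
  have leqn : #|(G / N)%G| <= n by apply: leq_trans leGn; apply: leq_quotient.
  have := IHm _ (G / N)%G ltm leqn (quotient_sol _ solG) (CPPO_quotient cG).
  have nNR1 := subset_trans sR1G nNG'; have nNR2 := subset_trans sR2G nNG'.
  rewrite /= !lcn_quotient // => KN1.
  by rewrite -quotient_sub1 ?(subset_trans sKR2) //; apply/trivgP.
have solR2 := solvableS sR2G solG; have solK := solvableS sKR2 solR2.
have abK : abelian K.
  apply/derG1P/eqP/negPn/negP=> ntK'.
  have := sol_der1_proper solK (subxx K) ntK.
  by rewrite properE minK ?andbF // (char_normal_trans (der_char _ _)).
have [r r_pr rK] := nilpotent_comm_pgroup cG nKG (abelian_nil abK) defKG ntK.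
have neKR2 : K != R2.
  apply: contraNneq ntK => KR2; rewrite -defK -KR2; exact/eqP/commG1P.
have nilR2K : nilpotent (R2 / K) := lcn_nilpotent_quotient _ _.
have [q q_pr qR2K] :=
  residual_pgroup_factor cG nR2G nKG sKR2 neKR2 nilR2K defR2G.
have nKR2 : K <| R2 := normalS sKR2 sR2G nKG.
(* If r = q, then R2 is nilpotent and its residual K is trivial. *)
have rq : r != q.
  apply: contraNneq ntK => rq;
    rewrite -rq pquotient_pgroup ?normal_norm // in qR2K.
  by rewrite (lcn_nilpotent_eq1 leR2 (pgroup_nil qR2K)).
have [Q sylQ] := Sylow_exists q R2.
have [sQR2 qQ _] := and3P sylQ.
have defKQ : K * Q = R2 := mul_Sylow_quotient nKR2 sylQ qR2K.
have r'Q : r^'.-group Q by apply: p_group_p'group qQ; rewrite eq_sym.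
have coKQ : coprime #|K| #|Q| := pnat_coprime rK r'Q.
have tiKQ := coprime_TIg coKQ.
pose M := 'N_G(Q)%G.
have sQG := subset_trans sQR2 sR2G.
have sQM : Q \subset M by rewrite subsetI sQG normG.
have nQM : M \subset 'N(Q) := subsetIr _ _.
have sMG : M \subset G := subsetIl _ _.
have nKGs := normal_norm nKG.
have nKQ := subset_trans sQG nKGs.
have defG : K * M = G.
  by rewrite -(Frattini_arg nR2G sylQ) -defKQ -mulgA (mulSGid sQM).
have commKQ : [~: K, Q] = K.
  rewrite -[RHS]defK -defKQ [LHS]commGC [RHS]commGC commMG.
    by rewrite [X in X * _](commG1P _) ?mul1g.
  by rewrite [X in 'N(X)](commG1P _) ?norm1 ?subsetT.
have cKQ1 : 'C_K(Q) = 1 by rewrite -{1}commKQ coprime_abel_cent_TI.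
have tiKM : K :&: M = 1.
  apply/trivgP; rewrite -cKQ1 subsetI subsetIl; apply/commG1P/trivgP.
  rewrite -tiKQ commg_subI // subsetI.
    by rewrite subsetIl (subset_trans (subsetIr _ _)).
  by rewrite subxx.
(* C_Q(K) is normal in G, and contains K if it is not trivial. *)
have faith : 'C_Q(K) = 1.
  apply/eqP/negPn/negP=> ntD; have nDG : 'C_Q(K) <| G.
    rewrite /normal subIset ?sQG // -defG mul_subG //.
      by rewrite cents_norm // centsC subsetIr.
    by rewrite normsI // norms_cent // (subset_trans sMG).
  have sKD := minK 'C_Q(K)%G nDG ntD.
  by case/negP: ntK;
    rewrite -subG1 -tiKQ subsetI subxx (subset_trans sKD) // subsetIl.
have ntR2 : R2 :!=: 1 by apply: contraNneq ntK => R21; rewrite -subG1 -R21.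
have neR21 : R2 != R1.
  apply: contraTneq (sol_der1_proper solR2 (subxx R2) ntR2) => E.
  by rewrite derg1 {2}E defR2 properxx.
have [s s_pr sR12] :=
  residual_pgroup_factor cG nR1G nR2G sR21 neR21 (lcn_nilpotent_quotient R1 n)
    defR1.
have nKR1 := subset_trans sR1G nKGs.
have ntR2K : R2 / K != 1.
  apply: contra neKR2 => /eqP E; rewrite -(inj_eq val_inj) /= eqEsubset sKR2.
  by rewrite -quotient_sub1 ?(subset_trans sR2G) //; apply/trivgP.
(* If s = q, then R1 / K is a q-group, and R2 / K = [R2 / K, R1 / K] = 1. *)
have sq : s != q.
  apply/eqP=> sq; have qR1K : q.-group (R1 / K).
    rewrite /pgroup card_quotient // -(Lagrange_index sR21 sKR2) pnatM.
    rewrite -!card_quotient ?(subset_trans sR1G) ?(subset_trans sR2G)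
      ?normal_norm //.
    by rewrite -{1}sq [X in X && _]sR12.
  have := nil_comm_properl
    (A := R1 / K) (pgroup_nil qR1K) (quotientS K sR21) ntR2K.
  rewrite subsetI subxx quotient_norms ?(subset_trans sR1G) ?normal_norm //.
  by rewrite -quotientR ?(subset_trans sR2G) // defR2 properxx => /(_ isT).
pose N1 := (M :&: R1)%G.
have defN1 : K * N1 = R1.
  by rewrite group_modl ?(subset_trans sKR2) // defG (setIidPr sR1G).
have tiN1R2 : R2 :&: N1 = Q.
  rewrite setIC -setIA (setIidPr sR21) -defKQ -group_modr //
    setIC tiKM mul1g //.
have sN1M : N1 \subset M := subsetIl _ _.
have sN1G := subset_trans sN1M sMG.
have sQN1 : Q \subset N1 by rewrite subsetI sQM (subset_trans sQR2).
have nQN1 : Q <| N1 by rewrite /normal sQN1 (subset_trans sN1M).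
have sN1Q : s.-group (N1 / Q).
  have nR2N1 : N1 \subset 'N(R2) by rewrite (subset_trans sN1G) ?normal_norm.
  rewrite /pgroup -tiN1R2 (card_isog (second_isog nR2N1)).
  by apply: pgroupS sR12; rewrite quotientS ?subsetIr.
have [S sylS] := Sylow_exists s N1.
have [sSN1 sS _] := and3P sylS.
have defQS : Q * S = N1 := mul_Sylow_quotient nQN1 sylS sN1Q.
have nN1M : N1 <| M
  by rewrite /normal sN1M normsI ?normG // (subset_trans sMG) ?normal_norm.
pose J := 'N_M(S)%G.
have sSM := subset_trans sSN1 sN1M.
have sSJ : S \subset J by rewrite subsetI sSM normG.
have sJM : J \subset M := subsetIl _ _.
have defM : Q * J = M.
  by rewrite -(Frattini_arg nN1M sylS) -defQS -mulgA (mulSGid sSJ).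
have q'S : q^'.-group S by apply: p_group_p'group sS.
have coQS : coprime #|Q| #|S| := pnat_coprime qQ q'S.
have nQS : S \subset 'N(Q) := subset_trans sSM nQM.
have cardQ (X : {group gT}) : K :&: X = 1 -> X \subset 'N(K) -> #|X / K| = #|X|.
  by move=> ti nK; rewrite card_quotient // -indexgI setIC ti indexg1.
have defQN1 : [~: Q, N1] = Q.
  apply/eqP; rewrite eqEcard commg_subl (subset_trans sN1M) //=.
  have sRQ : [~: Q, N1] \subset Q by rewrite commg_subl (subset_trans sN1M).
  rewrite -(cardQ Q) // -(cardQ [~: Q, N1]%G) ?(subset_trans sRQ) //;
    last first.
    by apply/trivgP; rewrite -tiKQ setIS.
  have nKN1 := subset_trans sN1G nKGs.
  rewrite /= quotientR //
    -[Q / K]quotientMidl -[N1 / K]quotientMidl defKQ defN1.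
  by rewrite -quotientR ?(subset_trans sR2G) // defR2.
have defQS' : [~: Q, S] = Q.
  have sRQ : [~: Q, S] \subset Q by rewrite commg_subl.
  have E : Q^`(1) * [~: S, Q] = Q.
    rewrite -[RHS]defQN1 [RHS]commGC -defQS commMG -?derg1 //.
    exact: (char_norm_trans (der_char 1 Q) nQS).
  have sQ'P : Q^`(1) \subset 'Phi(Q) by rewrite (Phi_joing qQ) joing_subl.
  rewrite -[LHS]genGid; apply: Phi_nongen; apply/eqP.
  rewrite eqEsubset join_subG Phi_sub sRQ /= -{1}E mul_subG //.
    by rewrite (subset_trans sQ'P) ?joing_subl.
  by rewrite commGC joing_subr.
have tiSR2 : R2 :&: S = 1.
  by rewrite -(setIidPr sSN1) setIA tiN1R2 (coprime_TIg coQS).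
have nR2S : S \subset 'N(R2)
  by rewrite (subset_trans sSN1) // (subset_trans sN1G) ?normal_norm.
have defSJ : [~: S, J] = S.
  have sRS : [~: S, J] \subset S by rewrite commg_subl subsetIr.
  have cardS (X : {group gT}) : X \subset S -> #|X / R2| = #|X|.
    move=> sXS; rewrite card_quotient ?(subset_trans sXS) // -indexgI setIC.
    have -> : R2 :&: X = 1 by apply/trivgP; rewrite -tiSR2 setIS.
    by rewrite indexg1.
  apply/eqP; rewrite eqEcard sRS /= -(cardS S) // -(cardS [~: S, J]%G) //.
  have nR2J : J \subset 'N(R2)
    by rewrite (subset_trans sJM) // (subset_trans sMG) ?normal_norm.
  have SR1 : S / R2 = R1 / R2.
    rewrite -defN1 -defQS mulgA defKQ quotientMidl //.
  have JG : J / R2 = G / R2.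
    rewrite -defG -defM mulgA defKQ quotientMidl //.
  by rewrite /= quotientR //
    SR1 JG -quotientR ?(subset_trans sR1G) ?normal_norm // defR1.
have cSt t : t \in J -> s^'.-elt t -> [~: S, <[t]>] \subset 'C(Q).
  move=> Jt s't; have Mt := subsetP sJM t Jt; have Gt := subsetP sMG t Mt.
  apply: (@tower_cent _ G K Q S t r q s); split=> //.
  - exact: normal_sub nKG.
  - exact: subset_trans sN1G.
  - by have /setIP[_ nSt] := Jt; apply: nSt.
  - exact: subsetP nQM t Mt.
  - exact: (subset_trans (subset_trans sSN1 sN1G) nKGs).
  - exact: subsetP nKGs t Gt.
pose C := 'C_S(Q)%G.
have nCJ : J \subset 'N(C).
  by rewrite normsI ?subsetIr // norms_cent // (subset_trans sJM).
have nCS := subset_trans sSJ nCJ.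
have SC1 : S / C = 1.
  apply: (@comm_p'elt_cent_trivial _ (S / C)%G (J / C)%G s).
  - by rewrite quotient_normal // /normal sSJ subsetIr.
  - exact: quotient_pgroup.
  - by rewrite -quotientR // defSJ.
  move=> _ /morphimP[x nx Jx ->] /= s'x.
  have -> : coset C x = coset C x.`_s^'
    by rewrite morph_constt //= constt_p_elt.
  have sC : [~: S, <[x.`_s^']>] \subset C.
    rewrite subsetI cSt ?groupX ?p_elt_constt // andbT commg_subl cycle_subG.
    by rewrite groupX //; have /setIP[_ nSx] := Jx; apply: nSx.
  rewrite -sub_cent1 -cent_cycle -quotient_cycle ?groupX // quotient_cents2 //.
  by rewrite cycle_subG groupX.
have cSQ : S \subset 'C(Q).
  have sSC : S \subset C by rewrite -quotient_sub1 // SC1.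
  by rewrite (subset_trans sSC) // subsetIr.
have Q1 : Q :=: 1 by rewrite -defQS'; apply/commG1P; rewrite centsC.
have KR2 : K :=: R2 by rewrite -defKQ Q1 mulg1.
by case/negP: neKR2; apply/eqP/val_inj.
Qed.

(** * Primes dividing the order of the commutator subgroup *)

(** The transfer of G into W kills the commutator subgroup, and maps a central z
    to its power with exponent the index of W, which is prime to p. *)
Lemma abelian_Sylow_central_der1 (gT : finGroupType) (G W : {group gT})
    (p : nat) z :
    p.-Sylow(G) W -> abelian W -> z \in W -> z \in 'C(G) -> z \in G^`(1) ->
  z = 1.
Proof.
move=> sylW abW Wz cGz G'z; have sWG := pHall_sub sylW.
have Gz := subsetP sWG z Wz.
have abI : abelian (idm W @* W) by rewrite morphim_idm.
pose tr := transfer_morphism G abI.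
have ker_tr : z \in 'ker tr.
  apply: subsetP G'z; rewrite gen_subG;
    apply/subsetP=> _ /imset2P[x y Gx Gy ->].
  apply/kerP; first by rewrite groupR.
  rewrite morphR //; apply/eqP/commgP; exact: GRing.addrC.
have sum_tr : transfer G abI z = (FiniteModule.fmod abI z *+ #|G : W|)%R.
  rewrite /transfer -GRing.sumr_const; apply: eq_bigr => _ /rcosetsP[x Gx ->].
  have cz g : g \in G -> commute g z by move=> Gg;
    apply/commute_sym/(centP cGz).
  have -> : (W :* x) :* z = W :* x.
    by rewrite -rcosetM cz // rcosetM (rcoset_id Wz).
  have Gr : repr (W :* x) \in G.
    have /rcosetP[w Ww ->] := mem_repr_rcoset W x.
    by rewrite groupM // (subsetP sWG).
  by rewrite cz // mulgK.
have zn : z ^+ #|G : W| = 1.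
  have Iz : z \in idm W @* W by rewrite morphim_idm.
  rewrite -(FiniteModule.fmodK abI Iz) -FiniteModule.fmvalZ -sum_tr.
  by rewrite -[transfer G abI z]/(tr z) (mker ker_tr).
apply/eqP; rewrite -order_eq1; apply/eqP; apply: (@pnat_1 p).
  exact: mem_p_elt (pHall_pgroup sylW) Wz.
have /and3P[_ _ p'GW] := sylW.
by apply: pnat_dvd p'GW; rewrite order_dvdn zn.
Qed.

(** If the next term of the derived series of C = C_G(F(G)) lies in F(G), it is
    central in C, so the term itself is nilpotent of class at most 2 and lies in
    F(G). *)
Lemma cent_sub_Fitting (gT : finGroupType) (G : {group gT}) :
  solvable G -> 'C_G('F(G)) \subset 'F(G).
Proof.
move=> solG; set C := 'C_G('F(G))%G.
have nCG : C <| G by rewrite /normal subsetIl normsI ?normG ?norms_cent ?gFnorm.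
have /derivedP[n] := solvableS (normal_sub nCG) solG.
move=> Cn1; have : C^`(n) \subset 'F(G) by rewrite Cn1 sub1G.
elim: n {Cn1} => // n IHn sCF; apply: IHn; apply: Fitting_max.
  exact: gFnormal_trans nCG.
apply: small_nil_class; apply: (@leq_trans 2) => //; rewrite nil_class2.
rewrite subsetI der_sub (subset_trans sCF) // centsC.
by rewrite (subset_trans (der_sub n C)) // subsetIr.
Qed.

(** Let O_q(G) be the noncentral part of F(G); the q'-part Z of F(G) is central.
    Let w <> q not divide the order of (G / F(G))', and let W be a Sylow
    w-subgroup.  A nontrivial z = [x, y] with x, y in W would lie in Z; then
    [x, y v] = [x, v] z for v in O_q(G) forces x to centralise O_q(G), so that x
    lies in F(G), in Z even, and z = 1.  So W is abelian.  The w-part of G' lies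
    in F(G), hence is central, and transfer shows that it is trivial. *)
Lemma primes_der1_Fitting (gT : finGroupType) (G : {group gT}) :
    solvable G -> CPPO G ->
  exists q, forall w, w \in primes #|G^`(1)| -> w != q ->
    w \in primes #|(G / 'F(G))^`(1)|.
Proof.
move=> solG cG; set F := 'F(G)%G.
have cFF : 'C_G(F) \subset F := cent_sub_Fitting solG.
have [cGF | ncGF] := boolP (G \subset 'C(F)).
  exists 2 => w; suff -> : G^`(1) = 1 by rewrite cards1.
  have sGF : G \subset F by rewrite (subset_trans _ cFF) // subsetI subxx.
  by apply/derG1P; apply: subset_trans cGF (centS sGF).
have [q q_pr ncA] : exists2 q, prime q & ~~ (G \subset 'C('O_q(G))).
  move: ncGF; rewrite /F /= FittingEgen cent_gen centsC => /subsetPn[x].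
  case/bigcupP=> q; rewrite mem_primes => /and3P[q_pr _ _] Ox ncx.
  by exists q => //; apply: contra ncx => cO; apply: (subsetP _ x Ox);
    rewrite centsC.
exists q => w w_pi wq; set A := 'O_q(G)%G in ncA; set Z := 'O_q^'(F)%G.
have nFG : F <| G := Fitting_normal G.
have [sFG nFG'] := andP nFG.
have nAG : A <| G := pcore_normal _ _.
have nZG : Z <| G := gFnormal_trans _ nFG.
have co : coprime #|A| #|Z|
  by apply: pnat_coprime (pcore_pgroup _ _) (pcore_pgroup _ _).
have cGZ : G \subset 'C(Z).
  by have := normal_coprime_central cG nAG nZG co; rewrite (negPf ncA).
have nilF : nilpotent F := Fitting_nil G.
have defF : A * Z = F.
  by have := nilpotent_pcoreC q nilF;
    rewrite p_core_Fitting => /dprodP[_ defF _ _]; apply: defF.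
have memZ z : z \in F -> w.-elt z -> z \in Z.
  move=> Fz wz;
    rewrite (mem_normal_Hall (nilpotent_pcore_Hall _ nilF)) ?pcore_normal //.
  by apply: pi_pnat wz _; rewrite !inE.
have CAF x : x \in G -> x \in 'C(A) -> x \in F.
  move=> Gx cAx; apply: (subsetP cFF); rewrite inE Gx /= -defF centM inE cAx.
  exact: subsetP cGZ x Gx.
apply/negPn/negP=> nw.
move: w_pi nw; rewrite !mem_primes !cardG_gt0 /= => /andP[w_pr w_dv];
  rewrite w_pr /= => nw.
have [W sylW] := Sylow_exists w G; have [sWG wW _] := and3P sylW.
have abW : abelian W.
  apply/centsP=> x Wx y Wy; apply/commgP/negPn/negP; set z := [~ x, y] => z1.
  have [Gx Gy] := (subsetP sWG x Wx, subsetP sWG y Wy).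
  have Wz : z \in W by rewrite groupR.
  have wz := mem_p_elt wW Wz.
  have Fz : z \in F.
    have nz : z \in 'N(F) by rewrite (subsetP nFG') ?groupR.
    apply: coset_idr => //; apply/eqP; rewrite -order_eq1; apply/eqP.
    apply: (@pnat_1 w); first exact: morph_p_elt.
    have Dz : coset F z \in (G / F)^`(1).
      by rewrite morphR ?(subsetP nFG') // mem_commg ?mem_quotient.
    apply: mem_p_elt Dz; by rewrite /pgroup p'natE.
  have Zz := memZ z Fz wz.
  have cz g : g \in G -> commute z g.
    by move=> Gg; apply/commute_sym/(centP (subsetP cGZ g Gg)).
  have cAx : x \in 'C(A).
    apply/centP=> v Av; apply/commgP/negPn/negP=> xv1.
    have Gv : v \in G := subsetP (normal_sub nAG) v Av.
    have Axv : [~ x, v] \in A.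
      rewrite commgEr groupM // memJ_norm ?groupV //.
      exact: subsetP (normal_norm nAG) x Gx.
    have [p [k [p_pr]]] := cG x (y * v) Gx (groupM Gy Gv).
    have -> : [~ x, y * v] = [~ x, v] * z.
      by rewrite commgMJ; congr (_ * _); apply/conjg_fixP/commgP/cz.
    apply: (@prime_power_not_mixed _ q) => //.
    - by apply/commute_sym/cz; rewrite groupR.
    - exact: mem_p_elt (pcore_pgroup _ _) Axv.
    - exact: mem_p_elt (pcore_pgroup _ _) Zz.
  have Zx : x \in Z := memZ x (CAF x Gx cAx) (mem_p_elt wW Wx).
  by case/commgP: z1; apply/commute_sym/(centP (subsetP cGZ y Gy)).
have sG'G := der_sub 1 G.
have dvI : w %| #|G^`(1) :&: F|.
  have := w_dv; rewrite -(LagrangeI G^`(1) F) Euclid_dvdM //.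
  have nFG1 := subset_trans sG'G nFG'.
  by rewrite -card_quotient // quotient_der // (negPf nw) orbF.
have [z /setIP[G'z Fz] oz] := Cauchy w_pr dvI.
have wz : w.-elt z by rewrite /p_elt oz pnat_id.
have Zz := memZ z Fz wz.
have Gz := subsetP sG'G z G'z.
have cGz : z \in 'C(G) by rewrite -sub_cent1; apply: subset_trans cGZ _;
  rewrite -cent_set1 centS ?sub1set.
have Wz : z \in W.
  have szG : <[z]> \subset G by rewrite cycle_subG.
  have [g Gg] := Sylow_Jsub sylW szG wz; rewrite -cycleJ cycle_subG.
  by have -> : z ^ g = z by apply/conjg_fixP/commgP/(centP cGz).
have z1 := abelian_Sylow_central_der1 sylW abW Wz cGz G'z.
by move: oz w_pr; rewrite z1 order1 => <-.
Qed.

Lemma size_primes_der1_Fitting (gT : finGroupType) (G : {group gT}) :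
    solvable G -> CPPO G ->
  (size (primes #|G^`(1)|) <= (size (primes #|(G / 'F(G))^`(1)|)).+1)%N.
Proof.
move=> solG cG; have [q Hq] := primes_der1_Fitting solG cG.
rewrite -[X in (_ <= X)%N]/(size (q :: primes #|(G / 'F(G))^`(1)|)).
apply: uniq_leq_size (primes_uniq _) _ => w w_pi; rewrite inE.
by case: eqVneq => //= wq; apply: Hq.
Qed.

Theorem theorem1p1 (gT : finGroupType) (G : {group gT})
    (solG : solvable G) (cppoG : CPPO G) :
  (fitting_height solG <= 3)%N /\ (size (primes #|(G^`(1))%g|) <= 3)%N.
Proof.
set n := #|G|; set R1 := 'L_n.+1(G)%G; set R2 := 'L_n.+1(R1)%G.
have R3 : 'L_n.+1(R2) = 1 := CPPO_residual_trivial (leqnn n) solG cppoG.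
have nilR2 : nilpotent R2 by apply/lcnP; exists n.
have chR1 : R1 \char G := lcn_char _ _.
have chR2 : R2 \char G := char_trans (lcn_char _ _) chR1.
split.
  rewrite /fitting_height; case: ex_minnP => h _; apply.
  apply/existsP; exists [tuple R2; R1; G]; rewrite /= eqxx !andbT.
  rewrite /invariant_factor !norms1 ?char_norm ?lcn_normal ?normal1 ?char_normal
    //=.
  rewrite !lcn_nilpotent_quotient (quotient_nil _ nilR2) //.
have sR2F : R2 \subset 'F(G) by apply: Fitting_max (char_normal chR2) nilR2.
set Y := (G / 'F(G))%G; set Y2 := (Y / 'F(Y))%G.
have [solY cY] : solvable Y /\ CPPO Y by split;
  [apply: quotient_sol | apply: CPPO_quotient].
have [solY2 cY2] : solvable Y2 /\ CPPO Y2 by split;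
  [apply: quotient_sol | apply: CPPO_quotient].
have sR1F : R1 / 'F(G) \subset 'F(Y).
  apply: Fitting_max; first by rewrite quotient_normal ?char_normal.
  apply/lcnP; exists n; rewrite lcn_quotient; last first.
    by rewrite (subset_trans (char_sub chR1)) ?gFnorm.
  by apply/trivgP; rewrite quotient_sub1 // (subset_trans sR2F) ?normG.
have nilY2 : nilpotent Y2.
  apply/lcnP; exists n; rewrite lcn_quotient ?gFnorm // lcn_quotient ?gFnorm //.
  apply/trivgP; rewrite quotient_sub1 //; apply: subset_trans sR1F _.
  by rewrite gFsub_trans ?gFnorm.
apply: leq_trans (size_primes_der1_Fitting solG cppoG) _; rewrite ltnS.
apply: leq_trans (size_primes_der1_Fitting solY cY) _; rewrite ltnS.
apply: leq_trans (size_primes_der1_Fitting solY2 cY2) _; rewrite ltnS.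
have -> : (Y2 / 'F(Y2))^`(1) = 1; last by rewrite cards1.
by rewrite nilpotent_Fitting // trivg_quotient; apply/commG1P; apply: sub1G.
Qed.
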